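(* Let $X_1,X_2,\ldots$ be the limit age-ordered frequencies generated by an exchangeable Gibbs partition EGP$(\alpha,V)$ with $\alpha<1$, and let $W_m=\sum_{i=1}^mX_i$. For every $m=1,2,\ldots$ and $\phi\ge0$, $$\mathbb{E}(W_m^\phi\mid i_m)=(i_m-\alpha m)_{(\phi)}\,\frac{V_{i_m,m}[\phi]}{V_{i_m,m}}$$ and $$\mathbb{E}(X_m^\phi\mid i_m)=(1-\alpha)_{(\phi)}\,\frac{V_{i_m,m}[\phi]}{V_{i_m,m}},$$ where $i_m$ is the $m$-th record index, for a family of functions $\phi\mapsto V_{n,k}[\phi]\in\mathbb{R}$ ($\phi\ge0$, $1\le k\le n$), uniquely determined by $V_{n,k}\equiv V_{n,k}[0]$, such that for every $\phi\ge0$ $$V_{1,1}[\phi]=\frac{\mathbb{E}(X_1^\phi)}{(1-\alpha)_{(\phi)}};$$ $$V_{n,k}[\phi]=(n+\phi-\alpha k)V_{n+1,k}[\phi]+V_{n+1,k+1}[\phi],\qquad 1\le k\le n;$$ $$V_{n,k}[\phi+1]=V_{n+1,k}[\phi],\qquad 1\le k\le n.$$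
   Context: Notation: $a_{(x)}=\Gamma(a+x)/\Gamma(a)$ for real $x\ge0$. A random partition of $[n]=\{1,\ldots,n\}$ is written $\Pi_n=(\Pi_{n1},\ldots,\Pi_{nk})$ with classes ordered by their least elements. For a consistent family $\Pi=(\Pi_n)$ (a random partition of $\mathbb{N}$), the record indices $1=i_1<i_2<\cdots$ are the least elements of its classes, and the limit age-ordered frequencies are $X_j=\lim_{n\to\infty}|\Pi_{nj}|/n$. Conditional statements given $i_m$ are for finite values of $i_m$ taken with positive probability. Let $\alpha\in(-\infty,1]$ and let $V=(V_{n,k}:1\le k\le n)$ be nonnegative coefficients with $V_{1,1}=1$ and $V_{n,k}=(n-\alpha k)V_{n+1,k}+V_{n+1,k+1}$. The exchangeable Gibbs partition EGP$(\alpha,V)$ is the random partition $\Pi=(\Pi_n)$ of $\mathbb{N}$ generated by: $\Pi_1=(\{1\})$; for $n\ge1$, given $\Pi_n=(\pi_{n1},\ldots,\pi_{nk})$ with class sizes $n_j=|\pi_{nj}|$, the element $n+1$ starts a new class with probability $V_{n+1,k+1}/V_{n,k}$, and joins the class $\pi_{nj}$ with probability $\frac{n_j-\alpha}{n-\alpha k}\left(1-\frac{V_{n+1,k+1}}{V_{n,k}}\right)$, $j=1,\ldots,k$. *)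

(* Defs.v *)
From HB Require Import structures.
From mathcomp Require Export all_boot all_order all_algebra.
From mathcomp Require Export all_classical all_reals all_analysis.

Set Implicit Arguments.
Unset Strict Implicit.
Unset Printing Implicit Defensive.

Import Order.TTheory GRing.Theory Num.Theory.
Import numFieldNormedType.Exports.

Local Open Scope classical_set_scope.
Local Open Scope ring_scope.

(* Euler's integral; only meaningful for x > 0. *)
Definition Gamma (R : realType) (x : R) : R :=
  \int[@lebesgue_measure R]_(t in `]0, +oo[) (t `^ (x - 1) * expR (- t)).

(* The generalized rising factorial a_(x), for a > 0 and x >= 0. *)
Definition rising (R : realType) (a x : R) : R := Gamma (a + x) / Gamma a.

Definition gibbs_coefficients (R : realType) (alpha : R) (V : nat -> nat -> R)
    : Prop :=
  [/\ forall n k, (1 <= k <= n)%N -> 0 <= V n k,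
      V 1%N 1%N = 1 &
      forall n k, (1 <= k <= n)%N ->
        V n k = (n%:R - alpha * k%:R) * V n.+1 k + V n.+1 k.+1].

(* A partition of {1, ..., n} is represented by the list of its classes, by
   increasing order of their least elements, each class being the increasing
   list of its elements; this representation is unique. *)
Definition ordered_partition (n : nat) (p : seq (seq nat)) : bool :=
  [&& perm_eq (flatten p) (iota 1 n),
      all (fun c => c != [::]) p,
      all (sorted ltn) p &
      sorted ltn [seq head 0%N c | c <- p]].

Definition restrict_partition (n : nat) (p : seq (seq nat)) : seq (seq nat) :=
  [seq c <- [seq [seq x <- c | (x <= n)%N] | c <- p] | c != [::]].

(* The j-th class for j >= 1 (classes are numbered from 1), empty if there are
   fewer than j classes. *)
Definition nth_class (p : seq (seq nat)) (j : nat) : seq nat :=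
  nth [::] p j.-1.

Definition open_class (x : nat) (p : seq (seq nat)) : seq (seq nat) :=
  rcons p [:: x].

Definition join_class (x j : nat) (p : seq (seq nat)) : seq (seq nat) :=
  set_nth [::] p j.-1 (rcons (nth_class p j) x).

Section random_partitions.
Context {d : measure_display} {Omega : measurableType d} {R : realType}.
Variable P : probability Omega R.
Implicit Type Pi : nat -> Omega -> seq (seq nat).

Definition cond_prob (A B : set Omega) : R := fine (P (A `&` B)) / fine (P B).

Definition cond_expectation (Y : Omega -> R) (B : set Omega) : R :=
  (\int[P]_(w in B) Y w) / fine (P B).

Definition random_partition Pi : Prop :=
  [/\ forall n w, ordered_partition n (Pi n w),
      forall n w, restrict_partition n (Pi n.+1 w) = Pi n w &
      forall n p, measurable [set w | Pi n w = p]].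

(* Pi 1 = [:: [:: 1]] holds for every random partition, and Pi n determines
   Pi 1, ..., Pi n.-1 by consistency. *)
Definition EGP (alpha : R) (V : nat -> nat -> R) Pi : Prop :=
  random_partition Pi /\
  forall (n : nat) (p : seq (seq nat)), (1 <= n)%N ->
    (0 < P [set w | Pi n w = p])%E ->
    let k := size p in
    cond_prob [set w | Pi n.+1 w = open_class n.+1 p] [set w | Pi n w = p]
      = V n.+1 k.+1 / V n k /\
    forall j, (1 <= j <= k)%N ->
      cond_prob [set w | Pi n.+1 w = join_class n.+1 j p] [set w | Pi n w = p]
        = ((size (nth_class p j))%:R - alpha) / (n%:R - alpha * k%:R)
          * (1 - V n.+1 k.+1 / V n k).

(* The event i_m = n. It is empty for all n when there are fewer than m
   classes, i.e. when i_m is infinite. *)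
Definition record_index Pi (m n : nat) : set Omega :=
  [set w | exists N, (m <= size (Pi N w))%N
                     /\ head 0%N (nth_class (Pi N w) m) = n].

Definition frequency Pi (j : nat) (w : Omega) : R :=
  limn (fun n => (size (nth_class (Pi n w) j))%:R / n%:R : R).

Definition cumulative_frequency Pi (m : nat) (w : Omega) : R :=
  \sum_(1 <= i < m.+1) frequency Pi i w.

End random_partitions.

(* [Vphi phi n k] stands for V_{n,k}[phi], and [M phi] for E(X_1^phi). *)
Definition moment_family (R : realType) (alpha : R) (V : nat -> nat -> R)
    (M : R -> R) (Vphi : R -> nat -> nat -> R) : Prop :=
  (forall n k, (1 <= k <= n)%N -> Vphi 0 n k = V n k) /\
  forall phi, 0 <= phi ->
    [/\ Vphi phi 1%N 1%N = M phi / rising (1 - alpha) phi,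
        forall n k, (1 <= k <= n)%N ->
          Vphi phi n k = (n%:R + phi - alpha * k%:R) * Vphi phi n.+1 k
                         + Vphi phi n.+1 k.+1 &
        forall n k, (1 <= k <= n)%N -> Vphi (phi + 1) n k = Vphi phi n.+1 k].

(* Main.v *)
Require Import Defs.
From mathcomp Require Import measurable_realfun ring lra zify.
Import Order.TTheory GRing.Theory Num.Theory.
Import numFieldNormedType.Exports.
Local Open Scope classical_set_scope.
Local Open Scope ring_scope.

(** For a union of |J| classes present at time n, let A_N be its size at time N
minus alpha |J|, and let K_N be the number of classes. The backward recursion
  g_N(N, k) = V_{N,k},
  g_N(n, k) = (n + phi - alpha k) g_N(n + 1, k) + g_N(n + 1, k + 1)
makes (A_n)_(phi) g_N(n, K_n) / V_{n,K_n} a martingale in n <= N, so that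
  E((A_N)_(phi) | Pi_n) = (A_n)_(phi) g_N(n, K_n) / V_{n,K_n}.
Since Gamma is log-convex, (A - 1)^phi <= (A)_(phi) <= (A + phi)^phi; dividing by
N^phi and letting N go to infinity gives both moment formulas at once, with
V_{n,k}[phi] the limit of g_N(n, k) / N^phi: given i_m = n, the union of the first m
classes has A_n = n - alpha m, and the m-th class has A_n = 1 - alpha.

Almost sure convergence of A_N / N follows from the cases phi = 1, 2, which give
E(A_N / N - A_M / M)^2 <= C (1 / M - 1 / N) up to a shift of the indices: this is
summable along cubes, and the size of a union of classes is monotone in between. *)

(** * The Gamma function *)

(** The family has to be produced from [alpha] and [V] alone, before any partition is given, and the
    backward recursion by itself does not visibly make g_N / N^phi converge. So [gibbs_limit] is a
    bare [limn], and its convergence is extracted from the partition: if V_{n,k} is nonzero, some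
    partition of [n] with k classes has positive probability, and the moment convergence for its
    first class forces the limit to exist; if V_{n,k} = 0, the zero propagates and g vanishes. Zeros
    of V do occur, for instance when the number of classes is bounded, so every quotient by V has to
    be justified: partitions at a zero of V have probability 0. The event i_m = n is decided at time
    n: Pi_n has m classes, the last being {n}. Before the limit, all variables are functions of some
    Pi_N, which has finitely many values, and all expectations are finite sums. *)

Section Gamma_function.
Variable R : realType.
Implicit Types (x y t : R).
Local Notation mu := (@lebesgue_measure R).
Local Notation halfline := `]0%R, +oo[%classic.

Definition Gamma_integrand x t : R := t `^ (x - 1) * expR (- t).

(** Kept in the extended reals because finiteness is itself deduced from the functional equation;
    [Gamma] is the [fine] part. *)
Definition eGamma x : \bar R := (\int[mu]_(t in halfline) (Gamma_integrand x t)%:E)%E.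

Lemma Gamma_integrand_ge0 x t : 0 <= Gamma_integrand x t.
Proof. by rewrite mulr_ge0 ?powR_ge0 ?expR_ge0. Qed.

Lemma measurable_Gamma_integrand x D : measurable_fun D (Gamma_integrand x).
Proof.
apply: measurable_funTS; apply: measurable_funM => //.
exact: (measurableT_comp (@measurable_expR R)).
Qed.

Lemma eGamma_ge0 x : (0 <= eGamma x)%E.
Proof. by apply: integral_ge0 => t _; rewrite lee_fin Gamma_integrand_ge0. Qed.

Lemma continuous_powR_pos y t : 0 < t -> {for t, continuous (fun u : R => u `^ y)}.
Proof.
by move=> t0; apply: differentiable_continuous; apply/derivable1_diffP;
   apply: derivable_powR; rewrite in_itv/= t0.
Qed.

Lemma continuous_expRN : continuous (fun t : R => expR (- t)).
Proof.
move=> t; apply: (@continuous_comp _ _ _ (fun t : R => - t) (@expR R)).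
  exact: (@continuousN _ R^o).
exact: continuous_expR.
Qed.

(** Parts are taken on a compact interval away from 0, where all powers of t are differentiable. The
    boundary term vanishes later, by [Gamma_boundary]. *)
Lemma Gamma_parts x (a b : R) : 0 <= x -> 0 < a -> a < b ->
  (\int[mu]_(t in `[a, b]) (Gamma_integrand (x + 1) t)%:E =
   (a `^ x * expR (- a) - b `^ x * expR (- b))%:E
   + x%:E * \int[mu]_(t in `[a, b]) (Gamma_integrand x t)%:E)%E.
Proof.
move=> x0 a0 ab.
have pos t : t \in `[a, b] -> 0 < t.
  by rewrite in_itv/= => /andP[at_ _]; exact: lt_le_trans at_.
have poso t : t \in `]a, b[ -> 0 < t.
  by rewrite in_itv/= => /andP[at_ _]; exact: lt_trans at_.
have b0 : 0 < b by exact: lt_trans ab.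
have cpow y : {within `[a, b], continuous (fun u : R => u `^ y)}.
  apply: continuous_in_subspaceT => t; rewrite inE => /pos t0.
  exact: continuous_powR_pos.
pose f (t : R) := x * t `^ (x - 1); pose G (t : R) := - expR (- t).
have cf : {within `[a, b], continuous f}.
  apply: continuous_in_subspaceT => t; rewrite inE => /pos t0.
  apply: (@continuousM _ R^o (fun=> x) (fun u : R => u `^ (x - 1))).
    exact: cst_continuous.
  exact: continuous_powR_pos.
have cG : continuous G.
  by move=> t; apply: (@cvgN _ R^o); exact: continuous_expRN.
have := @integration_by_parts R (fun u : R => u `^ x) G f (fun t => expR (- t)) a b ab cf.
move=> IBP; rewrite (_ : \int[mu]_(t in _) _ =
  \int[mu]_(t in `[a, b]) (t `^ x * expR (- t))%:E)%E; last first.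
  by apply: eq_integral => t _; rewrite /Gamma_integrand addrK.
rewrite IBP //.
- rewrite /G; congr (_ + _)%E; first by congr EFin; ring.
  rewrite (_ : \int[mu]_(t in _) _ = \int[mu]_(t in `[a, b]) - (x%:E * (Gamma_integrand
    x t)%:E))%E; last first.
    by apply: eq_integral => t _; rewrite -EFinM -EFinN; congr EFin;
      rewrite /f /Gamma_integrand; ring.
  rewrite integral_ge0N ?oppeK ?ge0_integralZl//=.
  + by apply/measurable_EFinP; exact: measurable_Gamma_integrand.
  + by move=> t _; rewrite lee_fin Gamma_integrand_ge0.
  + by move=> t _; rewrite lee_fin mulr_ge0 ?Gamma_integrand_ge0.
- split.
  + by move=> t /poso t0; apply: derivable_powR; rewrite in_itv/= t0.
  + by apply: cvg_at_right_filter; exact: continuous_powR_pos.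
  + by apply: cvg_at_left_filter; exact: continuous_powR_pos.
- by move=> t /poso t0; rewrite powR_derive1 // in_itv/= t0.
- by apply: continuous_subspaceT; exact: continuous_expRN.
- split.
  + by move=> t _; exact: ex_derive.
  + by apply: cvg_at_right_filter; exact: cG.
  + by apply: cvg_at_left_filter; exact: cG.
- by move=> t _; rewrite derive1E derive_val mulrN1 opprK.
Qed.

(** The limit [l] may be 0, which continuity at positive reals does not reach; the exponent 0 is set
    apart since 0 to the power 0 is 1. *)
Lemma powR_cvg (u : nat -> R) (l y : R) : 0 <= y -> (forall n, 0 <= u n) ->
  u @ \oo --> l -> (fun n => u n `^ y) @ \oo --> l `^ y.
Proof.
rewrite le_eqVlt => /predU1P[<- u0 ul|y0 u0 ul].
  by under eq_fun do rewrite powRr0; rewrite powRr0; exact: cvg_cst.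
have l0 : 0 <= l.
  rewrite -(cvg_lim _ ul)//; apply: limr_ge; first by apply/cvg_ex; exists l.
  by near=> n.
move: l0; rewrite le_eqVlt => /predU1P[l0|l0]; last first.
  by apply: (@continuous_cvg _ _ _ _ _ u (fun v : R => v `^ y)) => //; exact: continuous_powR_pos.
move: ul; rewrite -l0 powR0 ?gt_eqF// => ul.
apply/cvgrPdist_lt => e e0; near=> n.
rewrite sub0r normrN ger0_norm ?powR_ge0//.
rewrite [ltRHS](_ : _ = (e `^ y^-1) `^ y); last first.
  by rewrite -powRrM mulVf ?gt_eqF// powRr1// ltW.
apply: gt0_ltr_powR => //; rewrite ?nnegrE ?powR_ge0//.
near: n; move/cvgrPdist_lt : ul => /(_ _ (powR_gt0 (y^-1) e0)).
by apply: filterS => n; rewrite sub0r normrN ger0_norm.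
Unshelve. all: by end_near. Qed.

(** The shift by 2 makes the endpoints distinct from the start, [1/2, 2], as [Gamma_parts]
    requires. *)
Definition Gamma_cutoff (i : nat) : set R := `[(i.+2%:R)^-1, i.+2%:R]%classic.

Lemma Gamma_cutoff_lt i : (i.+2%:R)^-1 < i.+2%:R :> R.
Proof. by rewrite (@lt_trans _ _ 1) ?invf_lt1 ?ltr1n. Qed.

Lemma bigcup_Gamma_cutoff : \bigcup_i Gamma_cutoff i = halfline.
Proof.
apply/seteqP; split => t.
  move=> [i _]; rewrite /Gamma_cutoff/= !in_itv/= andbT => /andP[+ _].
  by apply: lt_le_trans; rewrite invr_gt0.
rewrite /= in_itv/= andbT => t0.
exists (maxn (Num.truncn t) (Num.truncn t^-1)) => //.
rewrite /Gamma_cutoff/= in_itv/=; apply/andP; split.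
  rewrite -[leRHS]invrK lef_pV2 ?posrE ?invr_gt0//.
  by apply/ltW/(lt_le_trans (truncnS_gt _)); rewrite ler_nat ltnS leqW// leq_maxr.
by apply/ltW/(lt_le_trans (truncnS_gt _)); rewrite ler_nat ltnS leqW// leq_maxl.
Qed.

Lemma eGamma_cvg x :
  (\int[mu]_(t in Gamma_cutoff i) (Gamma_integrand x t)%:E)%E @[i --> \oo] --> eGamma x.
Proof.
rewrite /eGamma -bigcup_Gamma_cutoff.
apply: ge0_nondecreasing_set_cvg_integral.
- apply/nondecreasing_seqP => i; rewrite subsetEset => t.
  rewrite /Gamma_cutoff/= !in_itv/= => /andP[h1 h2]; apply/andP; split.
    by apply: le_trans h1; rewrite lef_pV2 ?posrE// ler_nat.
  by apply: (le_trans h2); rewrite ler_nat.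
- by move=> i; exact: measurable_itv.
- by move=> i; apply/measurable_EFinP; exact: measurable_Gamma_integrand.
- by move=> i t _; rewrite lee_fin Gamma_integrand_ge0.
Qed.

Lemma cvg_invS (k : nat) : (fun n => (n + k.+1)%:R^-1 : R) @ \oo --> (0 : R).
Proof.
under eq_fun do rewrite addnS.
by have := @cvg_harmonic R; rewrite -(cvg_shiftn k).
Qed.

Lemma Gamma_boundary x : 0 < x ->
  (fun i => (i.+2%:R^-1) `^ x * expR (- (i.+2%:R^-1)) - i.+2%:R `^ x * expR (- i.+2%:R)
    : R) @ \oo --> (0:R).
Proof.
move=> x0; rewrite -[X in _ --> X](subr0 0); apply: cvgB.
  apply: (@squeeze_cvgr _ _ _ _ (fun=> 0) (fun i => (i.+2%:R^-1) `^ x)).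
  - near=> i; rewrite mulr_ge0 ?powR_ge0 ?expR_ge0//=.
    by rewrite ler_piMr ?powR_ge0// -expR0 ler_expR oppr_le0 invr_ge0.
  - exact: cvg_cst.
  - rewrite -[X in _ --> X](@powR0 _ x) ?gt_eqF//.
    apply: powR_cvg; [exact: ltW| by []|].
    by under eq_fun do rewrite -addn2; exact: cvg_invS.
(* An integer above [x]: b^x <= b^k for b >= 1, and the exponential series gives b^k exp(-b) <= (k +
   1)! / b. *)
pose k := (Num.truncn x).+1.
apply: (@squeeze_cvgr _ _ _ _ (fun=> 0) (fun i => k.+1`!%:R * (i.+2%:R^-1))).
- near=> i; rewrite mulr_ge0 ?powR_ge0 ?expR_ge0//=.
  have b1 : 1 <= i.+2%:R :> R by rewrite ler1n.
  apply: (@le_trans _ _ (i.+2%:R ^+ k * expR (- i.+2%:R))).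
    apply: ler_wpM2r; first exact: expR_ge0.
    by rewrite -powR_mulrn//; apply: ler_powR => //; exact/ltW/truncnS_gt.
  rewrite expRN ler_pdivrMr ?expR_gt0//.
  have : i.+2%:R ^+ k.+1 / k.+1`!%:R <= expR i.+2%:R :> R.
    by apply: le_trans (expR_ge1Dxn k _) => //; rewrite lerDr.
  rewrite ler_pdivrMr ?ltr0n ?fact_gt0// => h.
  rewrite mulrAC ler_pdivlMr// -exprSr; lra.
- exact: cvg_cst.
- rewrite -[X in _ --> X](mulr0 (k.+1`!%:R)); apply: cvgM; first exact: cvg_cst.
  by under eq_fun do rewrite -addn2; exact: cvg_invS.
Unshelve. all: by end_near. Qed.

(** Both sides are limits of cutoff integrals; as the boundary terms are finite, the limits add up
    whether or not the integral is finite. *)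
Lemma eGammaS x : 0 < x -> eGamma (x + 1) = (x%:E * eGamma x)%E.
Proof.
move=> x0; apply: (cvg_unique _ (@eGamma_cvg (x + 1))) => //.
have -> : (fun i => \int[mu]_(t in Gamma_cutoff i) (Gamma_integrand (x + 1) t)%:E)%E =
  (fun i => ((i.+2%:R^-1) `^ x * expR (- (i.+2%:R^-1)) - i.+2%:R `^ x * expR (-
    i.+2%:R))%:E + x%:E * \int[mu]_(t in Gamma_cutoff i) (Gamma_integrand x t)%:E)%E.
  apply/funext => i; apply: Gamma_parts; [exact: ltW|by rewrite invr_gt0|exact: Gamma_cutoff_lt].
have [b0 bx] : (fun i => ((i.+2%:R^-1) `^ x * expR (- (i.+2%:R^-1)) - i.+2%:R `^ x *
  expR (- i.+2%:R) : R)%:E) @ \oo --> 0%E /\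
    (fun i => x%:E * \int[mu]_(t in Gamma_cutoff i) (Gamma_integrand x t)%:E)%E @ \oo
      --> (x%:E * eGamma x)%E.
  split; first by apply: cvg_EFin; [near=> i|exact: Gamma_boundary].
  by apply: cvgeZl => //; exact: eGamma_cvg.
by have := cvgeD _ b0 bx; rewrite add0e; apply; rewrite fin_num_adde_defr.
Unshelve. all: by end_near. Qed.

Lemma eGamma1 : eGamma 1 = 1%E.
Proof.
rewrite /eGamma (integral_itv_obnd_cbnd) //=; last first.
  by apply/measurable_EFinP; exact: measurable_Gamma_integrand.
rewrite -(@integral_exponential_pdf R 1 ltr01) integral_mkcond.
apply: eq_integral => t _; rewrite /exponential_pdf !patchE.
by case: ifPn => // _; rewrite /Gamma_integrand subrr powRr0 mulN1r.
Qed.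

(** Integers follow from the functional equation. For y >= 1 with integer part n, t^(y - 1) <= 1 +
    t^(n + 1). Below 1 the functional equation is read backwards. *)
Lemma eGamma_fin x : 0 < x -> (eGamma x < +oo)%E.
Proof.
have fin_nat (n : nat) : (eGamma n.+1%:R < +oo)%E.
  elim: n => [|n IH]; first by rewrite eGamma1 ltry.
  by rewrite -natr1 eGammaS//; apply: lte_mul_pinfty.
have fin_ge1 y : 1 <= y -> (eGamma y < +oo)%E.
  move=> y1; pose n := Num.truncn y.
  have : (eGamma 1 + eGamma n.+2%:R < +oo)%E by rewrite lte_add_pinfty// eGamma1 ltry.
  apply: le_lt_trans; rewrite /eGamma -ge0_integralD//=.
  - apply: ge0_le_integral => //=.
    + by move=> t _; rewrite lee_fin Gamma_integrand_ge0.
    + by apply/measurable_EFinP; exact: measurable_Gamma_integrand.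
    + by apply/measurable_EFinP; apply: measurable_funD; exact: measurable_Gamma_integrand.
    + move=> t; rewrite in_itv/= andbT => t0.
      rewrite lee_fin /Gamma_integrand -mulrDl ler_wpM2r ?expR_ge0//.
      rewrite subrr powRr0; have [t1|t1] := leP t 1.
        rewrite -[leLHS]addr0 lerD ?powR_ge0//.
        by rewrite -[leRHS](powRr0 t) ger_powR ?t0 ?t1// subr_ge0.
      rewrite -[leLHS]add0r lerD//; apply: ler_powR; first exact: ltW.
      rewrite lerD2r (le_trans (ltW (truncnS_gt _)))// ler_nat.
      exact: leqnSn.
  - by move=> t _; rewrite lee_fin Gamma_integrand_ge0.
  - by apply/measurable_EFinP; exact: measurable_Gamma_integrand.
  - by move=> t _; rewrite lee_fin Gamma_integrand_ge0.
  - by apply/measurable_EFinP; exact: measurable_Gamma_integrand.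
move=> x0; have : (eGamma (x + 1) < +oo)%E by apply: fin_ge1; rewrite lerDr ltW.
rewrite eGammaS//; case: (eGamma x) (eGamma_ge0 x) => [r||] //=.
- by move=> _ _; rewrite ltry.
- by rewrite gt0_muley ?lte_fin.
Qed.

Lemma GammaE x : Gamma x = fine (eGamma x).
Proof. by []. Qed.

Lemma EFin_Gamma x : 0 < x -> (Gamma x)%:E = eGamma x.
Proof.
by move=> x0; rewrite GammaE fineK// ge0_fin_numE ?eGamma_ge0 ?eGamma_fin.
Qed.

Lemma Gamma_ge0 x : 0 <= Gamma x.
Proof. by rewrite GammaE fine_ge0// eGamma_ge0. Qed.

Lemma Gamma1 : Gamma 1 = 1 :> R.
Proof. by rewrite GammaE eGamma1. Qed.

#[local] Opaque Gamma.

Lemma GammaS x : 0 < x -> Gamma (x + 1) = x * Gamma x.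
Proof.
move=> x0; apply: EFin_inj; rewrite EFinM !EFin_Gamma ?eGammaS//.
by rewrite addr_gt0.
Qed.

(** Hölder's inequality with exponents 1/p and 1/(1 - p), applied to the p-th and (1 - p)-th powers
    of the two integrands. *)
Lemma Gamma_log_convex x y (p : R) : 0 < x -> 0 < y -> 0 < p < 1 ->
  Gamma (p * x + (1 - p) * y) <= Gamma x `^ p * Gamma y `^ (1 - p).
Proof.
move=> x0 y0 /andP[p0 p1].
have q0 : 0 < 1 - p by rewrite subr_gt0.
have z0 : 0 < p * x + (1 - p) * y by rewrite addr_gt0// mulr_gt0.
pose f u r := (fun t : R => Gamma_integrand u t `^ r) \_ halfline.
have f0 u r t : 0 <= f u r t.
  by apply: restrict_ge0 => {}t _; exact: powR_ge0.
have mf u r : measurable_fun setT (f u r).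
  apply/(measurable_restrictT _ _).1; first exact: measurable_itv.
  apply: (measurableT_comp (@measurable_powR R r)).
  exact: measurable_Gamma_integrand.
have norm_f u r : 0 < u -> 0 < r ->
    (Lnorm mu (r^-1)%:E (EFin \o f u r) = (Gamma u `^ r)%:E)%E.
  move=> u0 r0; rewrite unlock invrK -poweR_EFin EFin_Gamma//; congr (_ `^ _)%E.
  rewrite /eGamma [RHS]integral_mkcond; apply: eq_integral => t _.
  rewrite /= ger0_norm ?f0// /f !patchE.
  case: ifPn => _; last by rewrite powR0// invr_eq0 gt_eqF.
  by rewrite -powRrM mulfV ?gt_eqF// powRr1// Gamma_integrand_ge0.
have := @hoelder _ _ R mu (f x p) (f y (1 - p)) p^-1 (1 - p)^-1 (mf _ _) (mf _ _).
rewrite !invr_gt0 !invrK => /(_ p0 q0 _); rewrite addrC subrK => /(_ erefl).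
rewrite !norm_f// -EFinM Lnorm1 => H.
rewrite -lee_fin EFin_Gamma//; apply: le_trans H.
rewrite le_eqVlt; apply/orP; left; apply/eqP.
rewrite /eGamma [LHS]integral_mkcond; apply: eq_integral => t _.
rewrite /= ger0_norm ?mulr_ge0// /f !patchE.
case: ifPn => [|_]; last by rewrite mulr0.
rewrite inE/= in_itv/= andbT => t0.
rewrite /Gamma_integrand !powRM ?powR_ge0 ?expR_ge0// -!powRrM -!expRM.
rewrite mulrACA -expRD -powRD; last by rewrite (gt_eqF t0) implybT.
by congr (_ `^ _ * expR _)%:E; ring.
Qed.

(** A zero at x spreads to every x + k by the functional equation; log-convexity between x and x + 2
    then annihilates an integer point, where Gamma is positive. *)
Lemma Gamma_gt0 x : 0 < x -> 0 < Gamma x.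
Proof.
move=> x0; rewrite lt_neqAle Gamma_ge0 andbT eq_sym; apply/negP => /eqP Gx0.
have GS k : Gamma (x + k%:R) = 0.
  elim: k => [|k IH]; first by rewrite addr0.
  by rewrite -natr1 addrA GammaS ?IH ?mulr0// ltr_wpDr.
have Gnat (n : nat) : 0 < Gamma n.+1%:R :> R.
  elim: n => [|n IH]; first by rewrite Gamma1.
  by rewrite -natr1 GammaS ?mulr_gt0.
(* [n] is the integer in ]x, x + 1], and n = (1 - s) x + s (x + 2). *)
pose n := (Num.truncn x).+1; pose s : R := (n%:R - x) / 2.
have xn : x < n%:R by exact: truncnS_gt.
have nx : n%:R <= x + 1 by rewrite -natr1 lerD2r truncn_le ltW.
have := @Gamma_log_convex x (x + 2) (1 - s) x0.
rewrite addr_gt0// => /(_ erefl).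
have -> : 0 < 1 - s < 1 by rewrite /s; apply/andP; split; lra.
move=> /(_ erefl); rewrite Gx0 (GS 2%N) !powR0; first last.
- by rewrite gt_eqF// /s; lra.
- by rewrite gt_eqF// /s; lra.
rewrite (_ : _ + _ = n%:R); last by rewrite /s; lra.
by rewrite mulr0 leNgt Gnat.
Qed.

(** * Rising factorials and their comparison with powers *)

Lemma rising0 x : 0 < x -> rising x 0 = 1.
Proof. by move=> x0; rewrite /rising addr0 divff// gt_eqF// Gamma_gt0. Qed.

Lemma rising_gt0 x y : 0 < x -> 0 <= y -> 0 < rising x y.
Proof. by move=> x0 y0; rewrite divr_gt0 ?Gamma_gt0// ltr_wpDr. Qed.

(** The identity behind the martingale: a union grows with probability proportional to its reduced
    size [x], and this factor turns (x + 1)_(y) back into a multiple of (x)_(y). *)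
Lemma rising_recl x y : 0 < x -> 0 <= y ->
  x * rising (x + 1) y = (x + y) * rising x y.
Proof.
move=> x0 y0; have G0 := Gamma_gt0 x x0.
rewrite /rising GammaS// (_ : x + 1 + y = x + y + 1); last by ring.
rewrite GammaS; last exact: ltr_wpDr.
by field; rewrite !gt_eqF.
Qed.

Lemma rising_recr x y : 0 < x -> 0 <= y ->
  rising x (y + 1) = (x + y) * rising x y.
Proof.
by move=> x0 y0; rewrite /rising addrA GammaS ?ltr_wpDr// mulrA.
Qed.

Lemma rising1 x : 0 < x -> rising x 1 = x.
Proof. by move=> x0; rewrite -[X in rising _ X]add0r rising_recr// rising0// addr0 mulr1. Qed.

Lemma rising2 x : 0 < x -> rising x 2 = x * (x + 1).
Proof.
by move=> x0; rewrite (_ : 2 = 1 + 1)// rising_recr ?ler01// rising1// mulrC.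
Qed.

(** Log-convexity at x + y, between x with weight 1/(y + 1) and x + y + 1: raised to the power y +
    1, it reads Gamma(x + y)^(y + 1) <= Gamma(x) ((x + y) Gamma(x + y))^y. *)
Lemma rising_le x y : 0 < x -> 0 <= y -> rising x y <= (x + y) `^ y.
Proof.
rewrite le_eqVlt => x0 /predU1P[<-|y0]; first by rewrite rising0// powRr0.
have xy0 : 0 < x + y by rewrite addr_gt0.
have y1 : 0 < y + 1 by rewrite addr_gt0.
have [Gx Gxy] := (Gamma_gt0 x x0, Gamma_gt0 (x + y) xy0).
pose p := (y + 1)^-1.
have p1 : 1 - p = y * p by rewrite /p; field; rewrite gt_eqF.
have := @Gamma_log_convex x (x + y + 1) p x0.
rewrite addr_gt0// => /(_ erefl).
have -> : 0 < p < 1 by rewrite invr_gt0 y1 invf_lt1 ?ltrDr.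
move=> /(_ erefl); rewrite (_ : p * x + _ = x + y); last first.
  by rewrite /p; field; rewrite gt_eqF.
rewrite GammaS// p1 powRrM -powRM ?powR_ge0 ?Gamma_ge0//.
move=> /(ge0_ler_powR (ltW y1)); rewrite !nnegrE powR_ge0 Gamma_ge0 => /(_ isT isT).
rewrite -[X in _ <= X -> _]powRrM mulVf ?gt_eqF// powRr1; last first.
  by rewrite mulr_ge0 ?powR_ge0// Gamma_ge0.
rewrite powRD ?(gt_eqF Gxy) ?implybT// powRr1 ?Gamma_ge0//.
rewrite powRM ?Gamma_ge0 ?(ltW xy0)// => h.
rewrite /rising ler_pdivrMr//.
by rewrite -(ler_pM2l (powR_gt0 y Gxy)) (le_trans h)// le_eqVlt; apply/orP; left; apply/eqP; ring.
Qed.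

(** Log-convexity at x, between x + y with weight 1/(y + 1) and x - 1: Gamma(x)^(y + 1) <= Gamma(x +
    y) Gamma(x - 1)^y. *)
Lemma rising_ge x y : 1 < x -> 0 <= y -> (x - 1) `^ y <= rising x y.
Proof.
move=> x1; rewrite le_eqVlt => /predU1P[<-|y0].
  by rewrite rising0 ?powRr0// (lt_trans _ x1).
have xm0 : 0 < x - 1 by rewrite subr_gt0.
have x0 : 0 < x by exact: lt_trans x1.
have xy0 : 0 < x + y by rewrite addr_gt0.
have y1 : 0 < y + 1 by rewrite addr_gt0.
have [Gxm Gxy] := (Gamma_gt0 (x - 1) xm0, Gamma_gt0 (x + y) xy0).
pose p := (y + 1)^-1.
have p0 : 0 < p by rewrite invr_gt0.
have p1 : 1 - p = y * p by rewrite /p; field; rewrite gt_eqF.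
have := @Gamma_log_convex (x + y) (x - 1) p xy0 xm0.
have -> : 0 < p < 1 by rewrite p0 invf_lt1 ?ltrDr.
move=> /(_ erefl); rewrite (_ : p * _ + _ = x); last first.
  by rewrite /p; field; rewrite gt_eqF.
rewrite p1 powRrM -powRM ?powR_ge0 ?Gamma_ge0//.
move=> /(ge0_ler_powR (ltW y1)); rewrite !nnegrE powR_ge0 Gamma_ge0 => /(_ isT isT).
rewrite -[X in _ <= X -> _]powRrM mulVf ?gt_eqF// powRr1; last first.
  by rewrite mulr_ge0 ?powR_ge0// Gamma_ge0.
have Gx : Gamma x = (x - 1) * Gamma (x - 1) by rewrite -GammaS// subrK.
have Gx0 := Gamma_gt0 x x0.
rewrite powRD ?(gt_eqF Gx0) ?implybT// powRr1 ?Gamma_ge0//.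
rewrite [in X in X * _]Gx powRM ?Gamma_ge0 ?(ltW xm0)// => h.
rewrite /rising ler_pdivlMr//.
by rewrite -(ler_pM2r (powR_gt0 y Gxm)) mulrAC (le_trans h).
Qed.

End Gamma_function.

(** * The backward recursion *)

(** Limit form of [gibbs_backwardD1]: with N = l + n + 1, the factor l + 1 over N is 1 - n / N, and
    the remaining term carries 1 / N. *)
Lemma cvg_shift_average (R : realType) (n : nat) (u v : nat -> R) (a b : R) :
  u @ \oo --> a -> v @ \oo --> b ->
  (fun l => (1 - n%:R / (l + n.+1)%:R) * u l + (l + n.+1)%:R^-1 * v l) @ \oo --> a.
Proof.
move=> ua vb; have invS := @cvg_invS R n.
rewrite (_ : a = (1 - n%:R * 0) * a + 0 * b); last by ring.
apply: cvgD; apply: cvgM => //.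
by apply: cvgB; [exact: cvg_cst|apply: cvgM; [exact: cvg_cst|exact: invS]].
Qed.

Section backward_recursion.
Variables (R : realType) (alpha : R) (V : nat -> nat -> R).
Hypotheses (alpha_lt1 : alpha < 1) (hV : gibbs_coefficients alpha V).
Implicit Types (phi : R) (l n k : nat).

(** This is g_N(n, k) for N = n + l; counting the distance [l] to the horizon makes the recursion
    structural. *)
Fixpoint gibbs_backward phi l n k : R :=
  if l is l'.+1 then (n%:R + phi - alpha * k%:R) * gibbs_backward phi l' n.+1 k
                     + gibbs_backward phi l' n.+1 k.+1
  else V n k.

Lemma gibbs_denom_gt0 n k : (1 <= k <= n)%N -> 0 < n%:R - alpha * k%:R.
Proof.
move=> /andP[k1 kn]; have kn' : k%:R <= n%:R :> R by rewrite ler_nat.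
have k0 : 0 < k%:R :> R by rewrite ltr0n.
have : alpha * k%:R < 1 * k%:R by rewrite ltr_pM2r.
by rewrite mul1r subr_gt0 => /lt_le_trans; apply.
Qed.

Lemma gibbs_rec n k : (1 <= k <= n)%N ->
  V n k = (n%:R - alpha * k%:R) * V n.+1 k + V n.+1 k.+1.
Proof. by case: hV => _ _; exact. Qed.

Lemma gibbs_ge0 n k : (1 <= k <= n)%N -> 0 <= V n k.
Proof. by case: hV => + _ _; exact. Qed.

(** Both terms of the recursion are nonnegative. Zeros of V thus propagate, which makes
    [gibbs_backward] vanish wherever its denominator V does. *)
Lemma gibbs_eq0_succ n k : (1 <= k <= n)%N -> V n k = 0 ->
  V n.+1 k = 0 /\ V n.+1 k.+1 = 0.
Proof.
move=> kn V0; have c0 := gibbs_denom_gt0 n k kn.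
have a0 : 0 <= V n.+1 k by apply: gibbs_ge0; lia.
have b0 : 0 <= V n.+1 k.+1 by apply: gibbs_ge0; lia.
have := gibbs_rec n k kn; rewrite V0 => /esym/eqP.
rewrite paddr_eq0 ?mulr_ge0 ?(ltW c0)// mulf_eq0 gt_eqF//=.
by move=> /andP[/eqP-> /eqP->].
Qed.

Lemma gibbs_backward_eq0 phi l n k : (1 <= k <= n)%N -> V n k = 0 ->
  gibbs_backward phi l n k = 0.
Proof.
elim: l n k => [//|l IH] n k kn V0 /=.
have [V1 V2] := gibbs_eq0_succ n k kn V0.
by rewrite !IH ?mulr0 ?addr0//; lia.
Qed.

Lemma gibbs_backward0 l n k : (1 <= k <= n)%N -> gibbs_backward 0 l n k = V n k.
Proof.
elim: l n k => [//|l IH] n k kn /=.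
by rewrite !IH ?addr0 -?gibbs_rec//; lia.
Qed.

(* This exact finite identity yields V[phi + 1](n, k) = V[phi](n + 1, k) after
   dividing by l ^ (phi + 1): the last term is of smaller order. *)
Lemma gibbs_backwardD1 phi l n k :
  gibbs_backward (phi + 1) l.+1 n k
  = l.+1%:R * gibbs_backward phi l n.+1 k + gibbs_backward phi l.+1 n k.
Proof.
elim: l n k => [|l IH] n k; first by rewrite /=; ring.
rewrite [LHS]/= -/(gibbs_backward (phi + 1) l.+1 n.+1 k)
  -/(gibbs_backward (phi + 1) l.+1 n.+1 k.+1) !IH.
rewrite /= -!(natr1 l) -!(natr1 (l.+1)) -!natr1; ring.
Qed.

(** The closed forms for phi = 1 and 2 feed the second-moment estimate, at a stage where no limit is
    known to exist. *)
Lemma gibbs_backward1 l n k : (1 <= k <= n)%N ->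
  gibbs_backward 1 l n k = l%:R * V n.+1 k + V n k.
Proof.
case: l => [|l] kn; first by rewrite mul0r add0r.
rewrite -[X in gibbs_backward X]add0r gibbs_backwardD1 gibbs_backward0; last by lia.
by rewrite gibbs_backward0.
Qed.

Lemma gibbs_backward2 l n k : (1 <= k <= n)%N ->
  gibbs_backward 2 l n k
  = l%:R * (l%:R - 1) * V n.+2 k + l%:R * 2 * V n.+1 k + V n k.
Proof.
case: l => [|l] kn; first by rewrite !mul0r !add0r.
rewrite (_ : 2 = 1 + 1 :> R)// gibbs_backwardD1 !gibbs_backward1; [|lia..].
by rewrite -!natr1; ring.
Qed.

(** A divergent sequence would give a default value, so the relations below take convergence as a
    hypothesis; [gibbs_limit_is_cvg] supplies it once a Gibbs partition is available. *)
Definition gibbs_limit phi n k : R :=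
  limn (fun l => gibbs_backward phi l n k / (n + l)%:R `^ phi).

(** The horizons n + (l + 1) and (n + 1) + l agree, so the three terms have the same
    normalisation. *)
Lemma gibbs_limit_rec phi n k :
  cvgn (fun l => gibbs_backward phi l n.+1 k / (n.+1 + l)%:R `^ phi) ->
  cvgn (fun l => gibbs_backward phi l n.+1 k.+1 / (n.+1 + l)%:R `^ phi) ->
  gibbs_limit phi n k = (n%:R + phi - alpha * k%:R) * gibbs_limit phi n.+1 k
                        + gibbs_limit phi n.+1 k.+1.
Proof.
move=> c1 c2; apply/cvg_lim => //; rewrite -cvg_shiftS.
rewrite (_ : [sequence _]_n = fun l => (n%:R + phi - alpha * k%:R) *
    (gibbs_backward phi l n.+1 k / (n.+1 + l)%:R `^ phi) +
    gibbs_backward phi l n.+1 k.+1 / (n.+1 + l)%:R `^ phi); last first.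
  by apply/funext => l /=; rewrite addnS addSn mulrDl mulrA.
by apply: cvgD => //; apply: cvgM => //; exact: cvg_cst.
Qed.

#[local] Arguments gibbs_backward : simpl never.

Lemma gibbs_limitD1 phi n k :  0 <= phi ->
  cvgn (fun l => gibbs_backward phi l n k / (n + l)%:R `^ phi) ->
  cvgn (fun l => gibbs_backward phi l n.+1 k / (n.+1 + l)%:R `^ phi) ->
  gibbs_limit (phi + 1) n k = gibbs_limit phi n.+1 k.
Proof.
move=> phi0 c1 c2; rewrite [LHS]/gibbs_limit; apply: cvg_lim; first exact: Rhausdorff.
rewrite -(cvg_shiftS (fun l => gibbs_backward (phi + 1) l n k / (n + l)%:R `^ (phi + 1))).
rewrite (_ : [sequence _]_n = fun l => (1 - n%:R / (l + n.+1)%:R) *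
    (gibbs_backward phi l n.+1 k / (n.+1 + l)%:R `^ phi) +
    (l + n.+1)%:R^-1 * (gibbs_backward phi l.+1 n k / (n + l.+1)%:R `^ phi)); last first.
  apply/funext => l /=.
  rewrite gibbs_backwardD1 addnS -addSn (addnC n.+1).
  have N0 : 0 < (l + n.+1)%:R :> R by rewrite ltr0n addnS.
  rewrite powRD; last by rewrite (gt_eqF N0) implybT.
  rewrite powRr1 ?ler0n//.
  have := powR_gt0 phi N0; move: (_ `^ phi) => y y0.
  have -> : l.+1%:R = (l + n.+1)%:R - n%:R :> R.
    by rewrite -natrB; [congr _%:R; lia|lia].
  by field; rewrite !gt_eqF.
apply: (@cvg_shift_average R n
  (fun l => gibbs_backward phi l n.+1 k / (n.+1 + l)%:R `^ phi)
  (fun l => gibbs_backward phi l.+1 n k / (n + l.+1)%:R `^ phi) _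
  (gibbs_limit phi n k)); first exact: c2.
by move: c1; rewrite -(cvg_shiftS (fun l => gibbs_backward phi l n k / (n + l)%:R `^ phi)).
Qed.

Lemma gibbs_limit0 n k : (1 <= k <= n)%N -> gibbs_limit 0 n k = V n k.
Proof.
move=> kn; rewrite /gibbs_limit; under eq_fun do rewrite gibbs_backward0// powRr0 divr1.
exact: lim_cst.
Qed.

(** The shift in phi fills the column k = 1, V_{n+1,1}[phi] = V_{1,1}[phi + n]; the recursion then
    gives each column from the previous one by subtraction. *)
Lemma moment_family_unique (M : R -> R) (U U' : R -> nat -> nat -> R) :
  moment_family alpha V M U -> moment_family alpha V M U' ->
  forall phi n k, 0 <= phi -> (1 <= k <= n)%N -> U' phi n k = U phi n k.
Proof.
move=> [_ hU] [_ hU'] phi n k phi0.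
elim: k n => // -[|k] IH [//|n] kn.
  elim: n phi phi0 {kn IH} => [|n IHn] phi phi0.
    by have [-> _ _] := hU phi phi0; have [-> _ _] := hU' phi phi0.
  have [_ _ s] := hU phi phi0; have [_ _ s'] := hU' phi phi0.
  by rewrite -s// -s'// IHn// addr_ge0.
have [_ r _] := hU phi phi0; have [_ r' _] := hU' phi phi0.
have kn1 : (1 <= k.+1 <= n)%N by lia.
have := r _ _ kn1; have := r' _ _ kn1.
rewrite !IH//; last by lia.
by move=> -> /addrI.
Qed.

End backward_recursion.

(** * Ordered partitions *)

Section ordered_partitions.
Local Open Scope nat_scope.
Implicit Types (p q : seq (seq nat)) (c : seq nat) (n j x : nat).

Definition children n p : seq (seq (seq nat)) :=
  open_class n.+1 p :: [seq join_class n.+1 j p | j <- iota 1 (size p)].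

Lemma ordered_partition_le n p c x : ordered_partition n p ->
  c \in p -> x \in c -> x <= n.
Proof.
move=> /and4P[pp _ _ _] cp xc.
have : x \in flatten p by apply/flattenP; exists c.
by rewrite (perm_mem pp) mem_iota add1n ltnS => /andP[].
Qed.

Lemma sorted_rcons_lt c x y : sorted ltn (rcons c x) -> y \in c -> y < x.
Proof.
rewrite -cats1 => + yc.
rewrite (sorted_pairwise ltn_trans) pairwise_cat => /and3P[/allrelP + _ _].
by apply; rewrite ?inE.
Qed.

Lemma sorted_rcons_max c x : sorted ltn c -> x \in c ->
  (forall y, y \in c -> y <= x) -> exists c', c = rcons c' x.
Proof.
case/lastP: c => // c y /sorted_rcons_lt h xc le_x; exists c; congr rcons.
move: xc; rewrite mem_rcons inE => /predU1P[//|/h xy].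
by have := le_x y; rewrite mem_rcons inE eqxx => /(_ isT); lia.
Qed.

(** The largest element n + 1 is last in its class. Deleting it leaves a nonempty class, which it
    had joined, or empties a singleton, which the order by least elements puts last. *)
Lemma ordered_partition_children n q : ordered_partition n.+1 q ->
  q \in children n (restrict_partition n q).
Proof.
move=> oq; have le_q := ordered_partition_le _ _ _ _ oq.
have /and4P[pq /allP ne_q /allP sq hq] := oq.
have /flattenP[c cq nc] : n.+1 \in flatten q.
  by rewrite (perm_mem pq) mem_iota; lia.
have uq : uniq (flatten q) by rewrite (perm_uniq pq) iota_uniq.
case/splitPr: cq hq pq oq le_q ne_q sq uq => q1 q2 hq pq oq le_q ne_q sq.
rewrite flatten_cat /= cat_uniq cat_uniq => /and3P[_ dq1 /and3P[_ dq2 _]].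
have keep d : d \in q1 ++ q2 -> [seq x <- d | x <= n] = d.
  move=> dq; apply/all_filterP/allP => x xd.
  have dq' : d \in q1 ++ c :: q2.
    by move: dq; rewrite !mem_cat inE => /orP[->//|->]; rewrite !orbT.
  have := le_q _ _ dq' xd; rewrite leq_eqVlt => /predU1P[xn|//].
  move: dq; rewrite mem_cat => /orP[d1|d2].
    move/hasPn : dq1 => /(_ n.+1); rewrite mem_cat nc => /(_ isT)/negP[].
    by apply/flattenP; exists d; rewrite // -xn.
  move/hasPn : dq2 => /(_ n.+1) H; exfalso; move: (H); rewrite nc.
  suff: n.+1 \in flatten q2 by move=> -> /(_ isT).
  by apply/flattenP; exists d; rewrite // -xn.
have filt qi : {subset qi <= q1 ++ q2} ->
    [seq d <- [seq [seq x <- d | x <= n] | d <- qi] | d != [::]] = qi.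
  move=> sub; have -> : [seq [seq x <- d | x <= n] | d <- qi] = qi.
    by apply: map_id_in => d /sub /keep.
  apply/all_filterP/allP => d /sub dq; apply: ne_q.
  by move: dq; rewrite !mem_cat inE => /orP[->//|->]; rewrite !orbT.
have sub1 : {subset q1 <= q1 ++ q2} by move=> d; rewrite mem_cat => ->.
have sub2 : {subset q2 <= q1 ++ q2} by move=> d; rewrite mem_cat orbC => ->.
have cq : c \in q1 ++ c :: q2 by rewrite mem_cat inE eqxx orbT.
have [c' cE] : exists c', c = rcons c' n.+1.
  by apply: sorted_rcons_max (sq _ cq) nc _ => x; exact: le_q.
have fc : [seq x <- c | x <= n] = c'.
  rewrite cE filter_rcons ltnn; apply/all_filterP/allP => x xc'.
  by move: (sq _ cq); rewrite cE => /sorted_rcons_lt/(_ xc').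
have rE : restrict_partition n (q1 ++ c :: q2) =
    q1 ++ (if c' != [::] then [:: c'] else [::]) ++ q2.
  rewrite /restrict_partition map_cat filter_cat /= fc filt//.
  by case: ifPn => _; rewrite filt.
rewrite rE; case: (eqVneq c' [::]) => /= [c'0|c'0].
  (* A class after {n + 1} would have its least element above n + 1. *)
  have q20 : q2 = [::].
    case: q2 hq le_q ne_q {keep filt sub1 sub2 dq1 dq2 pq oq sq cq rE} => // d q2 + le_q ne_q.
    have dq : d \in q1 ++ c :: d :: q2 by rewrite mem_cat !inE eqxx !orbT.
    rewrite map_cat (sorted_pairwise ltn_trans) pairwise_cat => /and3P[_ _] /=.
    rewrite cE c'0 /= => /andP[/andP[]].
    have := ne_q _ dq; case: d dq {ne_q le_q} (le_q _ (head 0 d) dq) => // x d dq.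
    by rewrite inE eqxx => /(_ isT) /= ? _ ?; lia.
  by rewrite q20 cats0 /children inE /open_class cE c'0 cats1 eqxx.
rewrite /children inE; apply/orP; right; apply/mapP; exists (size q1).+1.
  by rewrite mem_iota size_cat /=; lia.
rewrite /join_class /nth_class /= set_nthE size_cat /= addnS ltnS leq_addr.
rewrite take_size_cat// drop_cat ltnNge leqnSn /= subSn// subnn /= drop0.
by rewrite nth_cat ltnn subnn /= cE.
Qed.

Lemma size_join_class x j p : 1 <= j <= size p -> size (join_class x j p) = size p.
Proof. by move=> jp; rewrite size_set_nth; apply/maxn_idPr; lia. Qed.

Lemma nth_join_class x i j p : 1 <= i -> 1 <= j ->
  nth_class (join_class x j p) i =
  if i == j then rcons (nth_class p j) x else nth_class p i.
Proof.
case: i => // i _; case: j => // j _.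
by rewrite /nth_class /join_class nth_set_nth /= eqSS.
Qed.

Lemma nth_open_class x i p : 1 <= i <= size p ->
  nth_class (open_class x p) i = nth_class p i.
Proof. by case: i => // i /andP[_ ip]; rewrite /nth_class /open_class nth_rcons ip. Qed.

(** Needed to sum over pairs (Pi_n, Pi_{n+1}) without repetition. The number of classes singles out
    the new class, and the size of class i singles out joining it. *)
Lemma uniq_children n p : uniq (children n p).
Proof.
rewrite /= map_inj_in_uniq ?iota_uniq ?andbT.
  apply/mapP => -[j]; rewrite mem_iota add1n ltnS => jp /(congr1 size).
  by rewrite size_join_class// /open_class size_rcons => /eqP; rewrite gtn_eqF.
move=> i j; rewrite !mem_iota => ip jp /(congr1 (fun q => size (nth_class q i))).
rewrite !nth_join_class ?eqxx; [|lia..].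
by case: eqVneq => // _; rewrite size_rcons; lia.
Qed.

Lemma sumn_size_classes n p : ordered_partition n p ->
  \sum_(j <- iota 1 (size p)) size (nth_class p j) = n.
Proof.
move=> /and4P[pp _ _ _].
rewrite -[RHS](size_iota 1) -(perm_size pp) size_flatten sumnE.
rewrite /shape big_map (big_nth [::]) big_mkord.
rewrite (iotaDl 1 0) big_map -{1}(subn0 (size p)) -/(index_iota 0 (size p)) big_mkord.
by apply: eq_bigr.
Qed.

Lemma class_size_gt0 n p j : ordered_partition n p -> 1 <= j <= size p ->
  0 < size (nth_class p j).
Proof.
move=> /and4P[_ /allP h _ _] /andP[j1 jp]; rewrite lt0n size_eq0; apply: h.
by apply: mem_nth; case: j j1 jp.
Qed.

Lemma size_partition_le n p : ordered_partition n p -> size p <= n.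
Proof.
move=> op; rewrite -(sumn_size_classes _ _ op) -{1}(size_iota 1 (size p)).
rewrite -sum1_size !big_seq; apply: leq_sum => j; rewrite mem_iota => jp.
by apply: (class_size_gt0 _ _ _ op); lia.
Qed.

Lemma size_partition_gt0 n p : ordered_partition n p -> 0 < n -> 0 < size p.
Proof.
move=> op n0; rewrite lt0n; apply/eqP => p0.
by move: (sumn_size_classes _ _ op); rewrite p0 big_nil => n0'; rewrite -n0' in n0.
Qed.

Definition union_size (J : seq nat) p : nat :=
  \sum_(j <- J) size (nth_class p j).

Lemma union_size_open x J p : all (fun j => 1 <= j <= size p) J ->
  union_size J (open_class x p) = union_size J p.
Proof.
move=> /allP Jp; apply: eq_big_seq => j /Jp jp.
by rewrite nth_open_class.
Qed.

Lemma union_size_join x i J p : uniq J -> all (fun j => 1 <= j <= size p) J ->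
  1 <= i <= size p -> union_size J (join_class x i p) = union_size J p + (i \in J).
Proof.
move=> uJ /allP Jp ip; rewrite /union_size.
under eq_big_seq => j Jj.
  have jp := Jp _ Jj.
  rewrite nth_join_class; [|lia..].
  rewrite (_ : size _ = size (nth_class p j) + (j == i)); last first.
    by case: eqVneq => [->|_]; rewrite ?size_rcons ?addn1 ?addn0.
  over.
rewrite big_split /=; congr (_ + _).
rewrite -(count_uniq_mem _ uJ) -sum1_count [RHS]big_mkcond /=.
by apply: eq_bigr => j _; case: eqP.
Qed.

Lemma union_size_le n J p : ordered_partition n p -> uniq J ->
  all (fun j => 1 <= j) J -> union_size J p <= n.
Proof.
move=> op uJ /allP J1; rewrite -(sumn_size_classes _ _ op).
have -> : union_size J p = \sum_(j <- [seq j <- J | j <= size p]) size (nth_class p j).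
  rewrite big_filter [RHS]big_mkcond; apply: eq_big_seq => j /J1 j1 /=.
  by case: ifPn => // jp; rewrite /nth_class nth_default//; lia.
rewrite (perm_big [seq j <- iota 1 (size p) | j \in J]).
  by rewrite big_filter /= [leqRHS](bigID (mem J)) /= leq_addr.
apply: uniq_perm; rewrite ?filter_uniq ?iota_uniq// => j.
rewrite !mem_filter mem_iota andbC; case: (boolP (j \in J)) => //= /J1.
by move=> ->; rewrite add1n ltnS.
Qed.

End ordered_partitions.

(** * Finite-range integrals and almost sure convergence *)

Lemma prob_gt0_nonempty {d : measure_display} {Omega : measurableType d}
    {R : realType} {P : probability Omega R} {A : set Omega} :
  (0 < P A)%E -> exists w, A w.
Proof. by have [->|/set0P] := eqVneq A set0; first by rewrite measure0 ltxx. Qed.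

Section finite_range.
Context {d : measure_display} {Omega : measurableType d} {R : realType}.
Variables (P : probability Omega R) (T : eqType) (X : Omega -> T).
Hypothesis mX : forall t, measurable [set w | X w = t].
Implicit Types (s : seq T) (f : T -> R).

Lemma indicator_sum_integral f s :
  let Y w := \sum_(t <- s) f t * \1_[set w | X w = t] w in
  [/\ measurable_fun setT Y, P.-integrable setT (EFin \o Y) &
      \int[P]_w Y w = \sum_(t <- s) f t * fine (P [set w | X w = t])].
Proof.
elim: s => [|t s [mY iY eY]] Y.
  have -> : Y = fun=> 0 by apply/funext => w; rewrite /Y big_nil.
  by split => //; [exact: integrable0|rewrite Rintegral_cst// mul0r big_nil].
have m1 : measurable_fun setT (\1_[set w | X w = t] : Omega -> R) by [].
have i1 : P.-integrable setT (EFin \o (\1_[set w | X w = t] : Omega -> R)).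
  exact: integrable_indic.
have ift : P.-integrable setT (EFin \o (fun w => f t * \1_[set w | X w = t] w)).
  by have := integrableZl measurableT (f t) i1.
have -> : Y = (fun w => f t * \1_[set w | X w = t] w +
    \sum_(t <- s) f t * \1_[set w | X w = t] w).
  by apply/funext => w; rewrite /Y big_cons.
split.
- by apply: measurable_funD => //; apply: measurable_funM.
- exact: (integrableD measurableT ift iY).
- rewrite RintegralD//= eY big_cons; congr (_ + _).
  rewrite RintegralZl//; congr (_ * _).
  by rewrite /Rintegral/= integral_indic// setIT.
Qed.

Lemma finite_rangeE f s w : uniq s -> X w \in s ->
  f (X w) = \sum_(t <- s) f t * \1_[set w | X w = t] w.
Proof.
move=> us Xs; rewrite (bigD1_seq (X w))//= indicE mem_set// mulr1 big1 ?addr0//.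
move=> t tX; rewrite indicE memNset ?mulr0//= => Xt.
by rewrite Xt eqxx in tX.
Qed.

(** [T] carries no sigma-algebra: measurability of [f \o X] comes from the fibres of [X], for
    arbitrary [f]. *)
Lemma finite_range_integral f s : uniq s -> (forall w, X w \in s) ->
  [/\ measurable_fun setT (f \o X), P.-integrable setT (EFin \o (f \o X)) &
      \int[P]_w f (X w) = \sum_(t <- s) f t * fine (P [set w | X w = t])].
Proof.
move=> us Xs; have := indicator_sum_integral f s.
rewrite (_ : (fun w => _) = f \o X)//.
by apply/funext => w /=; rewrite -finite_rangeE.
Qed.

End finite_range.

(** For l >= 1, the largest k with (k + 1)^3 <= l; it moves by at most one when l does. *)
Fixpoint cube_index (l : nat) : nat :=
  if l is l'.+1 then
    if ((cube_index l').+2 ^ 3 <= l)%N then (cube_index l').+1 else cube_index l'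
  else 0.

Lemma cube_indexP l : (0 < l)%N ->
  ((cube_index l).+1 ^ 3 <= l < (cube_index l).+2 ^ 3)%N.
Proof.
case: l => // l _; elim: l => [//|l /andP[IH1 IH2]].
rewrite [cube_index l.+2]/= -/(cube_index l.+1).
case: ifPn => [h|]; last by rewrite -ltnNge => ->; rewrite andbT leqW.
rewrite h /= (@leq_ltn_trans ((cube_index l.+1).+2 ^ 3))//.
by rewrite ltn_exp2r.
Qed.

Lemma cube_index_cvg : cube_index @ \oo --> \oo.
Proof.
apply/cvgnyPge => K; near=> l.
have l0 : (0 < l)%N by near: l; exact: nbhs_infty_gt.
have /andP[_ h] := cube_indexP l l0.
rewrite -ltnS -ltnS -(ltn_exp2r _ _ (_ : 0 < 3)%N)// (leq_trans _ h)// ltnS.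
by near: l; exact: nbhs_infty_ge.
Unshelve. all: by end_near. Qed.

Section analysis.
Variable R : realType.

Lemma cvg_cube_ratio : (fun k => (k.+1 ^ 3)%:R / (k.+2 ^ 3)%:R : R) @ \oo --> (1 : R).
Proof.
pose u k : R := 1 - (k + 2)%:R^-1.
rewrite (_ : (fun _ => _) = fun k => u k * (u k * u k)); last first.
  apply/funext => k; rewrite !natrX -expr_div_n !exprS expr0 mulr1.
  have -> : k.+1%:R / k.+2%:R = u k; last by [].
  by rewrite /u addn2 -(natr1 k.+1); field; rewrite gt_eqF//; have := ler0n R k; lra.
have h : u @ \oo --> (1 - 0 : R).
  by apply: cvgB; [exact: cvg_cst|exact: (cvg_invS R 1)].
rewrite (_ : 1 = (1 - 0) * ((1 - 0) * (1 - 0)) :> R); last by rewrite subr0 !mulr1.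
by apply: cvgM => //; apply: cvgM.
Qed.

Lemma cvg_inv_cube : (fun k => (k.+1 ^ 3)%:R^-1 : R) @ \oo --> (0 : R).
Proof.
apply: (@squeeze_cvgr _ _ _ _ (fun=> 0) (fun k => (k + 1)%:R^-1)).
- near=> k; rewrite invr_ge0 ler0n /= lef_pV2 ?posrE ?ltr0n ?expn_gt0 ?addn1//.
  by rewrite ler_nat -{1}(expn1 k.+1) leq_pexp2l.
- exact: cvg_cst.
- exact: (cvg_invS R 0).
Unshelve. all: by end_near. Qed.

(** The estimates divide by the time l elapsed since n; the factor l / N = 1 - n / N, with N = n +
    l, restores the true denominator. *)
Lemma cvg_unshift (T : nat -> R) (n : nat) (x : R) :
  (fun l => T (n + l)%N / l%:R) @ \oo --> x -> (fun N => T N / N%:R) @ \oo --> x.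
Proof.
move=> h; rewrite -(cvg_shiftn n.+1) /=.
have h1 : (fun l => T (n + l.+1)%N / l.+1%:R) @ \oo --> x.
  by move: h; rewrite -(cvg_shiftS (fun l => T (n + l)%N / l%:R)).
have h2 : (fun l => 1 - n%:R * (l + n.+1)%:R^-1 : R) @ \oo --> (1 - n%:R * 0 : R).
  by apply: cvgB; [exact: cvg_cst|apply: cvgM; [exact: cvg_cst|exact: cvg_invS]].
rewrite (_ : x = x * (1 - n%:R * 0)); last by rewrite mulr0 subr0 mulr1.
rewrite (_ : (fun _ => _) = fun l => (T (n + l.+1)%N / l.+1%:R) * (1 - n%:R * (l + n.+1)%:R^-1)).
  exact: cvgM h1 h2.
apply/funext => l; have -> : (l + n.+1 = n + l.+1)%N by lia.
have e0 : 0 < l.+1%:R :> R by rewrite ltr0n.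
have e1 : 0 < (n + l.+1)%:R :> R by rewrite ltr0n addnS.
rewrite natrD in e1 *.
by field; rewrite !gt_eqF.
Qed.

(** By monotonicity t(l) / l lies between the averages at the two cubes enclosing l, up to the ratio
    of these cubes, which tends to 1. *)
Lemma cvg_along_cubes (t : nat -> R) (x : R) : (forall l, 0 <= t l) ->
  {homo t : i j / (i <= j)%N >-> i <= j} ->
  (fun k => t (k.+1 ^ 3)%N / (k.+1 ^ 3)%:R) @ \oo --> x ->
  (fun l => t l / l%:R) @ \oo --> x.
Proof.
move=> t0 tmono tx.
pose lo k := (t (k.+1 ^ 3)%N / (k.+1 ^ 3)%:R) * ((k.+1 ^ 3)%:R / (k.+2 ^ 3)%:R).
pose hi k := (t (k.+2 ^ 3)%N / (k.+2 ^ 3)%:R) / ((k.+1 ^ 3)%:R / (k.+2 ^ 3)%:R).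
have lox : lo @ \oo --> x.
  by rewrite -[x]mulr1; apply: cvgM => //; exact: cvg_cube_ratio.
have hix : hi @ \oo --> x.
  rewrite -[x]divr1; apply: cvgM.
    by move: tx; rewrite -(cvg_shiftS (fun k => t (k.+1 ^ 3)%N / (k.+1 ^ 3)%:R)).
  by apply: cvgV => //; exact: cvg_cube_ratio.
apply: (@squeeze_cvgr _ _ _ _ (lo \o cube_index) (hi \o cube_index)).
- near=> l.
  have l0 : (0 < l)%N by near: l; exact: nbhs_infty_gt.
  have /andP[h1 h2] := cube_indexP l l0; rewrite /lo /hi /=.
  set k := cube_index l in h1 h2 *.
  have k1 : 0 < (k.+1 ^ 3)%:R :> R by rewrite ltr0n expn_gt0.
  have k2 : 0 < (k.+2 ^ 3)%:R :> R by rewrite ltr0n expn_gt0.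
  have lR : 0 < l%:R :> R by rewrite ltr0n.
  rewrite invf_div !mulrA !divfK ?gt_eqF//; apply/andP; split.
    apply: ler_pM => //.
      exact: tmono.
    by rewrite lef_pV2// ler_nat ltnW.
  apply: ler_pM => //.
    by apply: tmono; exact: ltnW.
  by rewrite lef_pV2// ler_nat.
- exact: (cvg_comp _ _ cube_index_cvg lox).
- exact: (cvg_comp _ _ cube_index_cvg hix).
Unshelve. all: by end_near. Qed.

Context {d : measure_display} {Omega : measurableType d}.
Variable P : probability Omega R.

(** By monotone convergence the sum of the series has expectation at most M, hence is finite almost
    everywhere. *)
Lemma ae_cvg_series (U : nat -> Omega -> R) (M : R) :
  (forall k, measurable_fun setT (U k)) -> (forall k w, 0 <= U k w) ->
  (forall K, (\sum_(0 <= k < K) \int[P]_w (U k w)%:E <= M%:E)%E) ->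
  {ae P, forall w, cvgn (series (fun k => U k w))}.
Proof.
move=> mU U0 UM.
have mUE k : measurable_fun setT (fun w => (U k w)%:E) by exact/measurable_EFinP.
have intS : P.-integrable setT (fun w => \sum_(0 <= k <oo) (U k w)%:E)%E.
  apply/integrableP; split.
    by apply: ge0_emeasurable_sum => // k w _ _; rewrite lee_fin.
  under eq_integral.
    move=> w _; rewrite gee0_abs; last by apply: nneseries_ge0 => k _ _; rewrite lee_fin.
    over.
  rewrite integral_nneseries//; last by move=> k w _; rewrite lee_fin.
  apply: (@le_lt_trans _ _ M%:E); last exact: ltry.
  apply: lime_le.
    by apply: is_cvg_nneseries => k _ _; apply: integral_ge0 => w _; rewrite lee_fin.
  by near=> K; exact: UM.
have := integrable_ae measurableT intS.
apply: filterS => w /(_ I) fin.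
by apply: nnseries_is_cvg => //; move: fin; rewrite fin_numElt => /andP[].
Unshelve. all: by end_near. Qed.

End analysis.

(** * Measurability of pointwise limits *)

Section measurable_limit.
Context {R : realType} {d : measure_display} {Omega : measurableType d}.

(** Only countable quantifiers occur on the right, so the set of convergence is measurable. *)
Lemma cvgn_cauchy_dist (u : nat -> R) : cvgn u <->
  forall k, exists N, forall i, `|u (N + i)%N - u N| <= k.+1%:R^-1.
Proof.
split=> [/cvg_ex[l ul] k|h].
  have e0 : 0 < k.+1%:R^-1 / 2 :> R by rewrite divr_gt0.
  move/cvgrPdist_lt : ul => /(_ _ e0)[N _ hN].
  exists N => i; have h1 := hN N (leqnn N); have h2 := hN (N + i)%N (leq_addr i N).
  rewrite (_ : _ - _ = (l - u N) - (l - u (N + i)%N)); last by ring.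
  apply: le_trans (ler_normB _ _) _; rewrite [leRHS](splitr).
  by apply: lerD; exact: ltW.
apply/cauchy_cvgP/cauchy_exP => e e0.
pose k := Num.truncn e^-1.
have ke : k.+1%:R^-1 < e.
  by rewrite -[ltRHS]invrK ltf_pV2 ?posrE ?invr_gt0// truncnS_gt.
have [N hN] := h k; exists (u N), N => // m /= Nm.
rewrite /ball/= distrC -(subnKC Nm); exact: le_lt_trans (hN _) ke.
Qed.

Lemma measurable_limn (u : nat -> Omega -> R) :
  (forall n, measurable_fun setT (u n)) ->
  measurable_fun setT (fun w => limn (u ^~ w)).
Proof.
move=> mu; pose C := [set w | cvgn (u ^~ w)].
have mC : measurable C.
  have -> : C = \bigcap_k \bigcup_N \bigcap_i
      [set w | `|u (N + i)%N w - u N w| <= k.+1%:R^-1].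
    apply/seteqP; split => w.
      by move=> /cvgn_cauchy_dist h k _; have [N hN] := h k; exists N => // i _; exact: hN.
    by move=> h; apply/cvgn_cauchy_dist => k; have [N _ hN] := h k I; exists N => i;
      exact: (hN i I).
  apply: bigcapT_measurable => k; apply: bigcupT_measurable => N.
  apply: bigcapT_measurable => i.
  rewrite -[X in measurable X]setTI.
  pose f w := `|u (N + i)%N w - u N w|.
  have mf : measurable_fun setT f.
    by apply: measurableT_comp => //; exact: measurable_funB.
  have := mf measurableT _ (measurable_itv `]-oo, (k.+1%:R^-1 : R)]).
  by congr measurable; apply/seteqP; split => w /=; rewrite in_itv/=.
apply: (@measurable_fun_cvg _ _ _ _ (fun n w => u n w * \1_C w)).
  by move=> n; apply: measurable_funM.
move=> w _; have [Cw|Cw] := pselect (C w).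
  by rewrite indicE mem_set// (_ : (fun n => _) = u ^~ w)//; apply/funext => n; rewrite mulr1.
rewrite indicE memNset// (_ : (fun n => _) = fun=> 0); last by apply/funext => n; rewrite mulr0.
(* Off the set of convergence [limn] takes its default value 0, which is also the limit of the
   truncated sequence. *)
rewrite (_ : limn _ = 0); first exact: cvg_cst.
by apply/dvgP.
Qed.

End measurable_limit.

(** * Gibbs partitions *)

Section gibbs_partition.
Context {d : measure_display} {Omega : measurableType d} {R : realType}.
Variables (P : probability Omega R) (alpha : R) (V : nat -> nat -> R).
Variable Pi : nat -> Omega -> seq (seq nat).
Hypotheses (alpha_lt1 : alpha < 1) (hV : gibbs_coefficients alpha V).
Hypothesis hPi : EGP P alpha V Pi.
Implicit Types (n m N l k : nat) (p q : seq (seq nat)) (J : seq nat) (w : Omega).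
Implicit Types (z f : seq (seq nat) -> R).

Let ordPi n w : ordered_partition n (Pi n w).
Proof. by case: hPi => -[]. Qed.

Let restrPi n w : restrict_partition n (Pi n.+1 w) = Pi n w.
Proof. by case: hPi => -[]. Qed.

Let mPi n p : measurable [set w | Pi n w = p].
Proof. by case: hPi => -[]. Qed.

Lemma partition_step N w : Pi N.+1 w \in children N (Pi N w).
Proof. by rewrite -(restrPi N w); exact: ordered_partition_children. Qed.

Lemma partition0 w : Pi 0 w = [::].
Proof.
have /size_partition_le := ordPi 0 w.
by rewrite leqn0 size_eq0 => /eqP.
Qed.

Fixpoint partition_values N : seq (seq (seq nat)) :=
  if N is N'.+1 then undup (flatten [seq children N' p | p <- partition_values N'])
  else [:: [::]].

Lemma partition_values_uniq N : uniq (partition_values N).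
Proof. by case: N => [//|N]; exact: undup_uniq. Qed.

Lemma partition_valuesP N w : Pi N w \in partition_values N.
Proof.
elim: N => [|N IH]; first by rewrite partition0 inE.
rewrite mem_undup; apply/flattenP; exists (children N (Pi N w)).
  exact: map_f.
exact: partition_step.
Qed.

Definition discrete_integralE N f :=
  finite_range_integral P _ (Pi N) (mPi N) f _ (partition_values_uniq N) (partition_valuesP N).

Lemma discrete_measurable N f : measurable_fun setT (f \o Pi N).
Proof. by have [] := discrete_integralE N f. Qed.

Lemma discrete_integrable N f : P.-integrable setT (EFin \o (f \o Pi N)).
Proof. by have [] := discrete_integralE N f. Qed.

(** E(f(Pi_{N+1}) | Pi_N = p), as prescribed by the prediction rule. *)
Definition gibbs_kernel N f p : R :=
  let k := size p in
  V N.+1 k.+1 / V N k * f (open_class N.+1 p) +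
  \sum_(j <- iota 1 k) ((size (nth_class p j))%:R - alpha) / (N%:R - alpha * k%:R)
          * (1 - V N.+1 k.+1 / V N k) * f (join_class N.+1 j p).

Let mPi2 N (t : seq (seq nat) * seq (seq nat)) :
  measurable [set w | (Pi N w, Pi N.+1 w) = t].
Proof.
case: t => p q; rewrite [X in measurable X](_ : _ =
   [set w | Pi N w = p] `&` [set w | Pi N.+1 w = q]); first exact: measurableI.
by apply/seteqP; split => w /= [-> ->].
Qed.

(** The tower property, with [z] a factor known at time N. *)
Lemma one_step N z f : (1 <= N)%N ->
  \int[P]_w (z (Pi N w) * f (Pi N.+1 w)) =
  \int[P]_w (z (Pi N w) * gibbs_kernel N f (Pi N w)).
Proof.
move=> N1.
pose s := [seq (p, q) | p <- partition_values N, q <- children N p].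
have us : uniq s.
  apply: allpairs_uniq_dep.
  - exact: partition_values_uniq.
  - by move=> p _; exact: uniq_children.
  - by move=> [a b] [a' b'] _ _ /= [-> ->].
have ins w : (Pi N w, Pi N.+1 w) \in s.
  apply/allpairsPdep; exists (Pi N w), (Pi N.+1 w); split => //.
    exact: partition_valuesP.
  exact: partition_step.
have [_ _ ->] := finite_range_integral P _ (fun w => (Pi N w, Pi N.+1 w)) (mPi2 N)
  (fun t => z t.1 * f t.2) s us ins.
have [_ _ ->] := discrete_integralE N (fun p => z p * gibbs_kernel N f p).
rewrite big_allpairs_dep; apply: eq_bigr => p _ /=.
have joint q : [set w | (Pi N w, Pi N.+1 w) = (p, q)] =
   [set w | Pi N.+1 w = q] `&` [set w | Pi N w = p].
  by apply/seteqP; split => w /= [-> ->].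
under eq_bigr do rewrite joint.
(* The prediction rule covers partitions of positive probability only; the others contribute 0 to
   both sides. *)
have [p0|p0] := eqVneq (P [set w | Pi N w = p]) 0%E.
  rewrite p0 mulr0 big1// => q _.
  rewrite (_ : P _ = 0%E) ?mulr0//; apply/eqP; rewrite eq_le measure_ge0 andbT.
  by rewrite -p0 le_measure ?inE//; exact: measurableI.
have pgt0 : (0 < P [set w | Pi N w = p])%E by rewrite lt0e p0 measure_ge0.
have fgt0 : 0 < fine (P [set w | Pi N w = p]).
  by rewrite fine_gt0// pgt0/= (le_lt_trans (probability_le1 _ _))// ltry.
have [_ /(_ N p N1 pgt0)[ho hj]] := hPi.
rewrite /children big_cons big_map /gibbs_kernel mulrDr mulrDl; congr (_ + _).
  by rewrite -ho /cond_prob; field; rewrite gt_eqF.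
rewrite mulr_sumr mulr_suml; apply: eq_big_seq => j; rewrite mem_iota => jp.
rewrite -hj; last by lia.
by rewrite /cond_prob; field; rewrite gt_eqF.
Qed.

Lemma partition_prob_le N p q : restrict_partition N q = p ->
  (P [set w | Pi N.+1 w = q] <= P [set w | Pi N w = p])%E.
Proof.
move=> qp; apply: le_measure; rewrite ?inE//.
by move=> w /= wq; rewrite -(restrPi N w) wq.
Qed.

(** Opening a class has a probability proportional to V_{N+1,k+1}; joining one has probability 0 if
    V_{N+1,k} = 0, by the recursion. So no step of positive probability leads to a zero of V. *)
Lemma partition_prob_gt0 N p : (1 <= N)%N -> (0 < P [set w | Pi N w = p])%E ->
  V N (size p) != 0.
Proof.
case: N => // N _; elim: N p => [|N IH] q q0.
  have [w wq] : exists w, Pi 1 w = q.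
    by have [w] := prob_gt0_nonempty q0; exists w.
  rewrite -wq; have := partition_step 0 w; rewrite partition0 /= inE => /eqP->.
  by case: hV => _ /= -> _; exact: oner_neq0.
have [w wq] : exists w, Pi N.+2 w = q.
  by have [w] := prob_gt0_nonempty q0; exists w.
set p := Pi N.+1 w.
have p0 : (0 < P [set w | Pi N.+1 w = p])%E.
  by apply: lt_le_trans q0 _; apply: partition_prob_le; rewrite -wq.
have Vp := IH p p0.
have c0 : cond_prob P [set w | Pi N.+2 w = q] [set w | Pi N.+1 w = p] != 0.
  rewrite /cond_prob (_ : _ `&` _ = [set w | Pi N.+2 w = q]); last first.
    by apply/seteqP; split => [w' []//|w' /= wq']; split => //;
      rewrite -(restrPi N.+1 w') wq' -wq restrPi.
  rewrite mulf_neq0 ?invr_neq0// gt_eqF// fine_gt0//.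
    by rewrite q0 (le_lt_trans (probability_le1 _ _))// ltry.
  by rewrite p0 (le_lt_trans (probability_le1 _ _))// ltry.
have [_ /(_ N.+1 p isT p0)[ho hj]] := hPi.
have kn : (1 <= size p <= N.+1)%N.
  by rewrite (size_partition_gt0 _ _ (ordPi N.+1 w))//=; exact/size_partition_le/ordPi.
have := partition_step N.+1 w; rewrite wq inE => /predU1P[qE|/mapP[j + qE]].
  move: c0; rewrite qE ho size_rcons; apply: contraNneq => ->.
  by rewrite mul0r.
rewrite mem_iota add1n ltnS => jp.
move: c0; rewrite qE hj// size_join_class//; apply: contraNneq => V0.
rewrite (gibbs_rec _ _ _ hV _ _ kn) V0 mulr0 add0r divff ?subrr ?mulr0//.
by apply: contraNneq Vp => V1; rewrite (gibbs_rec _ _ _ hV _ _ kn) V0 V1 mulr0 addr0.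
Qed.

(** The licence to divide by V inside an expectation: its zeros are met on null events only. *)
Lemma discrete_eq N f g : (1 <= N)%N ->
  (forall w, V N (size (Pi N w)) != 0 -> f (Pi N w) = g (Pi N w)) ->
  \int[P]_w f (Pi N w) = \int[P]_w g (Pi N w).
Proof.
move=> N1 fg; have [_ _ ->] := discrete_integralE N f.
have [_ _ ->] := discrete_integralE N g; apply: eq_bigr => p _.
have [->|p0] := eqVneq (P [set w | Pi N w = p]) 0%E; first by rewrite !mulr0.
have pgt0 : (0 < P [set w | Pi N w = p])%E by rewrite lt0e p0 measure_ge0.
congr (_ * _); have [w wp] : exists w, Pi N w = p.
  by have [w] := prob_gt0_nonempty pgt0; exists w.
by rewrite -wp; apply: fg; rewrite wp; exact: partition_prob_gt0.
Qed.

(** * Unions of classes and the martingale *)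

Definition has_classes J p := all (fun j => 1 <= j <= size p)%N J.

(** The weight of the union in the prediction rule: an element that joins an existing class joins
    the union with probability [reduced_size J p] over n - alpha k. *)
Definition reduced_size J p : R := (union_size J p)%:R - alpha * (size J)%:R.

Lemma reduced_sizeE J p :
  reduced_size J p = \sum_(j <- J) ((size (nth_class p j))%:R - alpha).
Proof.
rewrite /reduced_size /union_size big_split /= -natr_sum; congr (_ + _).
by rewrite big_const_seq count_predT iter_addr_0 mulr_natr mulNrn.
Qed.

Lemma reduced_size_gt0 N J p : ordered_partition N p -> J != [::] ->
  has_classes J p -> 0 < reduced_size J p.
Proof.
move=> op; rewrite reduced_sizeE; case: J => // j J _ /= /andP[jp /allP Jp].
rewrite big_cons; apply: ltr_wpDr.
  rewrite big_seq; apply: sumr_ge0 => i /Jp ip.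
  have : 1 <= (size (nth_class p i))%:R :> R by rewrite ler1n (class_size_gt0 _ _ _ op).
  by move: alpha_lt1; lra.
have : 1 <= (size (nth_class p j))%:R :> R by rewrite ler1n (class_size_gt0 _ _ _ op).
by move: alpha_lt1; lra.
Qed.

Lemma has_classes_step J N w : has_classes J (Pi N w) -> has_classes J (Pi N.+1 w).
Proof.
have : (size (Pi N w) <= size (Pi N.+1 w))%N.
  have := partition_step N w; rewrite inE => /predU1P[->|/mapP[j + ->]].
    by rewrite /open_class size_rcons.
  by rewrite mem_iota add1n ltnS => jp; rewrite size_join_class.
move=> h; apply: sub_all => j /andP[-> /=] jp; exact: leq_trans h.
Qed.

(** A function of the number of classes and of the union size sees three moves only: a new class,
    growth of the union, growth elsewhere. *)
Lemma gibbs_kernelE N J p (h : nat -> nat -> R) : (1 <= N)%N ->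
  ordered_partition N p -> uniq J -> has_classes J p ->
  let k := size p in let t := union_size J p in
  gibbs_kernel N (fun q => h (size q) (union_size J q)) p
  = V N.+1 k.+1 / V N k * h k.+1 t
    + (1 - V N.+1 k.+1 / V N k) / (N%:R - alpha * k%:R) *
      (reduced_size J p * h k t.+1
       + (N%:R - alpha * k%:R - reduced_size J p) * h k t).
Proof.
move=> N1 op uJ Jp k t; rewrite /gibbs_kernel -/k union_size_open// /open_class size_rcons -/k -/t.
congr (_ + _).
set r := 1 - _; set c := N%:R - _.
have sumJ : \sum_(j <- iota 1 k) ((size (nth_class p j))%:R - alpha) * (j \in J)%:R
    = reduced_size J p.
  rewrite reduced_sizeE [RHS](perm_big [seq j <- iota 1 k | j \in J]); last first.
    apply: uniq_perm; rewrite ?filter_uniq ?iota_uniq// => j.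
    rewrite mem_filter mem_iota; apply/idP/andP => [Jj|[]//]; split => //.
    by move/allP : Jp => /(_ _ Jj); rewrite add1n ltnS.
  rewrite [RHS]big_filter [RHS]big_mkcond /=; apply: eq_bigr => j _.
  by case: ifP => _; rewrite ?mulr1 ?mulr0.
have sumk : \sum_(j <- iota 1 k) ((size (nth_class p j))%:R - alpha) = c.
  rewrite /c -(sumn_size_classes _ _ op) -/k natr_sum big_split /=; congr (_ + _).
  by rewrite big_const_seq count_predT iter_addr_0 size_iota mulr_natr mulNrn.
transitivity (\sum_(j <- iota 1 k)
   (r / c * h k t * ((size (nth_class p j))%:R - alpha)
    + r / c * (h k t.+1 - h k t) * (((size (nth_class p j))%:R - alpha) * (j \in J)%:R))).
  apply: eq_big_seq => j; rewrite mem_iota add1n ltnS => jp.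
  rewrite size_join_class// union_size_join// -/t -/k.
  by case: (j \in J); rewrite ?addn1 ?addn0 ?mulr1 ?mulr0 /=; ring.
rewrite big_split /= -!mulr_sumr sumJ sumk; ring.
Qed.

(** With c = N - alpha k, one step gives A (A + 1)_(phi) + (c - A) (A)_(phi) = (c + phi) (A)_(phi),
    and c + phi is the coefficient of the backward recursion. The factor [z] carries the
    conditioning. *)
Lemma rising_martingale J phi l N z : (1 <= N)%N -> uniq J -> J != [::] -> 0 <= phi ->
  (forall w, z (Pi N w) != 0 -> has_classes J (Pi N w)) ->
  \int[P]_w (z (Pi N w) * rising (reduced_size J (Pi (N + l) w)) phi) =
  \int[P]_w (z (Pi N w) * (rising (reduced_size J (Pi N w)) phi *
     (gibbs_backward _ alpha V phi l N (size (Pi N w)) / V N (size (Pi N w))))).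
Proof.
move=> N1 uJ J0 phi0; elim: l N N1 z => [|l IH] N N1 z zJ.
  rewrite addn0; apply: (discrete_eq N
    (fun p => z p * rising (reduced_size J p) phi)
    (fun p => z p * (rising (reduced_size J p) phi * (V N (size p) / V N (size p))))) => //.
  by move=> w Vw; rewrite divff// mulr1.
(* z(Pi_N) is read as a function of Pi_{N+1}, so that the induction hypothesis applies at time N +
   1. *)
transitivity (\int[P]_w (z (restrict_partition N (Pi N.+1 w)) *
    rising (reduced_size J (Pi (N.+1 + l) w)) phi)).
  by apply: eq_Rintegral => w _; rewrite restrPi addSnnS.
rewrite (IH N.+1 isT (fun q => z (restrict_partition N q))); last first.
  by move=> w; rewrite restrPi => /zJ/has_classes_step.
pose h k t := rising (t%:R - alpha * (size J)%:R) phi *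
   (gibbs_backward _ alpha V phi l N.+1 k / V N.+1 k).
transitivity (\int[P]_w (z (Pi N w) * h (size (Pi N.+1 w)) (union_size J (Pi N.+1 w)))).
  by apply: eq_Rintegral => w _; rewrite restrPi.
rewrite (one_step N z (fun q => h (size q) (union_size J q)))//.
apply: eq_Rintegral => w _.
have [->|zw] := eqVneq (z (Pi N w)) 0; first by rewrite !mul0r.
have Jw := zJ w zw; have op := ordPi N w.
congr (_ * _); rewrite gibbs_kernelE//.
set p := Pi N w in zw Jw op *; set k := size p; set t := union_size J p.
have kn : (1 <= k <= N)%N.
  by rewrite (size_partition_gt0 _ _ op)//= (size_partition_le _ _ op).
have a0 : 0 < reduced_size J p by exact: reduced_size_gt0 op _ _.
have c0 := gibbs_denom_gt0 _ _ alpha_lt1 _ _ kn.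
have h0 k' t' : V N.+1 k' = 0 -> h k' t' = 0 by move=> V0; rewrite /h V0 invr0 !mulr0.
(* Cleared of its denominator, the formula for [h] holds at zeros of V too. *)
have hE k' t' : (1 <= k' <= N.+1)%N -> V N.+1 k' * h k' t' =
   rising (t'%:R - alpha * (size J)%:R) phi * gibbs_backward _ alpha V phi l N.+1 k'.
  move=> kn'; rewrite /h; have [V0'|V0'] := eqVneq (V N.+1 k') 0.
    by rewrite V0' (gibbs_backward_eq0 _ _ _ alpha_lt1 hV _ _ _ _ kn')// mul0r mulr0.
  by field.
clearbody h.
have [V0|V0] := eqVneq (V N k) 0.
  have [V1 V2] := gibbs_eq0_succ _ _ _ alpha_lt1 hV _ _ kn V0.
  by rewrite V0 V2 !h0// !(invr0, mulr0, mul0r, add0r, addr0).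
(* By the recursion the probability of joining contains N - alpha k, which cancels the denominator
   of the prediction rule. *)
have -> : 1 - V N.+1 k.+1 / V N k = (N%:R - alpha * k%:R) * V N.+1 k / V N k.
  by rewrite -{1}(divff V0) -mulrBl [in X in X / _](gibbs_rec _ _ _ hV _ _ kn) addrK.
have [kn1 kn2] : (1 <= k <= N.+1)%N /\ (1 <= k.+1 <= N.+1)%N.
  by case/andP: kn => k1 kN; rewrite k1 leqW.
have h1 := hE k t.+1 kn1; have h2 := hE k t kn1; have h3 := hE k.+1 t kn2.
transitivity ((V N.+1 k.+1 * h k.+1 t + (reduced_size J p * (V N.+1 k * h k t.+1)
       + (N%:R - alpha * k%:R - reduced_size J p) * (V N.+1 k * h k t))) / V N k).
  by field; rewrite V0 gt_eqF.
rewrite h1 h2 h3.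
rewrite /= -/(reduced_size J p).
have -> : t.+1%:R - alpha * (size J)%:R = reduced_size J p + 1.
  by rewrite /reduced_size -/t -natr1; ring.
have := rising_recl _ _ _ a0 phi0; move: (rising (_ + 1) phi) => ra ha.
rewrite mulrA ha; field. exact: V0.
Qed.

Fixpoint restrict_iter n l p :=
  if l is l'.+1 then restrict_iter n l' (restrict_partition (n + l') p) else p.

Lemma restrict_iterE n l w : restrict_iter n l (Pi (n + l) w) = Pi n w.
Proof.
elim: l => [|l IH]; first by rewrite addn0.
by rewrite addnS /= restrPi.
Qed.

(** Such variables are integrable and stable under all binary operations, which settles the
    integrability conditions of the second-moment computation. *)
Definition discrete (Y : Omega -> R) := exists N f, Y = f \o Pi N.

Lemma discrete_comp N f : discrete (fun w => f (Pi N w)).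
Proof. by exists N, f. Qed.

(** Both variables are read off the partition at time N + N', whose restrictions recover the earlier
    ones. *)
Lemma discrete2 (Y Z : Omega -> R) (h : R -> R -> R) : discrete Y -> discrete Z ->
  discrete (fun w => h (Y w) (Z w)).
Proof.
move=> [N [f ->]] [N' [g ->]]; exists (N + N')%N.
exists (fun p => h (f (restrict_iter N N' p)) (g (restrict_iter N' N p))).
by apply/funext => w /=; rewrite restrict_iterE addnC restrict_iterE.
Qed.

Lemma discreteM (Y Z : Omega -> R) : discrete Y -> discrete Z ->
  discrete (fun w => Y w * Z w).
Proof. exact: (discrete2 _ _ (fun x y => x * y)). Qed.

Lemma discrete_integrableE (Y : Omega -> R) : discrete Y ->
  P.-integrable setT (EFin \o Y).
Proof. by move=> [N [f ->]]; exact: discrete_integrable. Qed.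

Lemma discrete_linear (Y Z : Omega -> R) (b c : R) : discrete Y -> discrete Z ->
  \int[P]_w (b * Y w + c * Z w) = b * \int[P]_w Y w + c * \int[P]_w Z w.
Proof.
move=> dY dZ; rewrite RintegralD//.
- by rewrite !RintegralZl//; exact: discrete_integrableE.
- by apply: discrete_integrableE; exact: (discrete2 _ _ (fun y _ => b * y) dY dY).
- by apply: discrete_integrableE; exact: (discrete2 _ _ (fun y _ => c * y) dZ dZ).
Qed.

(** * Moments and convergence on an event decided at time n *)

Section conditioning_event.
Variables (n m : nat) (S : pred (seq (seq nat))) (J : seq nat) (a : R).
Hypotheses (n_gt0 : (1 <= n)%N) (uJ : uniq J) (J0 : J != [::]).
Hypothesis hS : forall w, S (Pi n w) ->
  [/\ size (Pi n w) = m, reduced_size J (Pi n w) = a & has_classes J (Pi n w)].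
(** The number of classes and the reduced size are constant on this event. It serves for a single
    partition, for a record and for the sure event. *)
Let B := [set w | S (Pi n w)].
Let A l w := reduced_size J (Pi (n + l) w).

Lemma event_measurable : measurable B.
Proof.
have := discrete_measurable n (fun p => (S p)%:R) measurableT [set 1] (measurable_set1 1).
rewrite setTI; congr measurable; apply/seteqP; split => w /=; rewrite /B/=; case: (S _) => //.
by move=> /esym/eqP; rewrite oner_eq0.
Qed.

Lemma event_prob : \int[P]_w (S (Pi n w))%:R = fine (P B).
Proof.
rewrite -[in RHS](setIT B) -integral_indic//; last exact: event_measurable.
congr fine; apply: eq_integral => w _; rewrite indicE; congr EFin.
by rewrite /B; case: (boolP (S (Pi n w))) => h; [rewrite mem_set|rewrite memNset//; exact/negP].
Qed.

Lemma has_classes_event w l : S (Pi n w) -> has_classes J (Pi (n + l) w).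
Proof.
move=> /hS[_ _ h]; elim: l => [|l IH]; first by rewrite addn0.
by rewrite addnS; exact: has_classes_step.
Qed.

Lemma reduced_size_event_gt0 w l : S (Pi n w) -> 0 < A l w.
Proof.
by move=> Sw; apply: (reduced_size_gt0 (n + l)) => //; exact: has_classes_event.
Qed.

Lemma rising_mean l phi : 0 <= phi ->
  \int[P]_w ((S (Pi n w))%:R * rising (A l w) phi) =
  fine (P B) * (rising a phi * (gibbs_backward _ alpha V phi l n m / V n m)).
Proof.
move=> phi0; rewrite (rising_martingale J phi l n (fun p => (S p)%:R))//; last first.
  by move=> w; case: (boolP (S _)) => [/hS[]//|]; rewrite eqxx.
transitivity (\int[P]_w (rising a phi * (gibbs_backward _ alpha V phi l n m / V n m) *
  (S (Pi n w))%:R)).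
  apply: eq_Rintegral => w _; case: (boolP (S _)) => [/hS[-> -> _]|_];
    by rewrite ?mul1r ?mulr1 ?mul0r ?mulr0.
rewrite RintegralZl//; last exact: (discrete_integrable n (fun p => (S p)%:R)).
by rewrite event_prob mulrC.
Qed.

Hypothesis V0 : V n m != 0.
Hypothesis mn : (1 <= m <= n)%N.
Let p0 := fine (P B).
Let v1 := V n.+1 m / V n m.
Let v2 := V n.+2 m / V n m.

Lemma reduced_size_mean l : \int[P]_w ((S (Pi n w))%:R * A l w) = p0 * (a * (l%:R * v1 + 1)).
Proof.
transitivity (\int[P]_w ((S (Pi n w))%:R * rising (A l w) 1)).
  apply: eq_Rintegral => w _; case: (boolP (S _)) => [Sw|_]; last by rewrite !mul0r.
  by rewrite rising1// reduced_size_event_gt0.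
rewrite rising_mean//; have [B0|/set0P[w Bw]] := eqVneq B set0.
  by rewrite /p0 B0 measure0 !mul0r.
rewrite gibbs_backward1// rising1; first by rewrite /v1; congr (_ * (_ * _)); field.
by have [_ <- _] := hS _ Bw; have := reduced_size_event_gt0 w 0 Bw; rewrite /A addn0.
Qed.

Lemma reduced_size_mean2 l : \int[P]_w ((S (Pi n w))%:R * (A l w * (A l w + 1))) =
  p0 * (a * (a + 1) * (l%:R * (l%:R - 1) * v2 + l%:R * 2 * v1 + 1)).
Proof.
transitivity (\int[P]_w ((S (Pi n w))%:R * rising (A l w) 2)).
  apply: eq_Rintegral => w _; case: (boolP (S _)) => [Sw|_]; last by rewrite !mul0r.
  by rewrite rising2// reduced_size_event_gt0.
rewrite rising_mean//; have [B0|/set0P[w Bw]] := eqVneq B set0.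
  by rewrite /p0 B0 measure0 !mul0r.
rewrite gibbs_backward2// rising2; first by rewrite /v1/v2; congr (_ * (_ * _)); field.
by have [_ <- _] := hS _ Bw; have := reduced_size_event_gt0 w 0 Bw; rewrite /A addn0.
Qed.

Let ratio l w := V (n + l).+1 (size (Pi (n + l) w)) / V (n + l) (size (Pi (n + l) w)).

Let size_bounds N w : (1 <= N)%N -> (1 <= size (Pi N w) <= N)%N.
Proof.
by move=> N1; rewrite (size_partition_gt0 _ _ (ordPi N w))//= size_partition_le.
Qed.

(** Conditioning at the intermediate time n + l, case phi = 1: the mean of A_{l+j} is A_l (1 + j
    [ratio]). *)
Lemma reduced_size_cross_mean l j : \int[P]_w ((S (Pi n w))%:R * A l w * A (l + j) w) =
  \int[P]_w ((S (Pi n w))%:R * (A l w * A l w * (j%:R * ratio l w + 1))).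
Proof.
have nl : (1 <= n + l)%N by lia.
pose z p := (S (restrict_iter n l p))%:R * reduced_size J p.
transitivity (\int[P]_w (z (Pi (n + l) w) * rising (A (l + j) w) 1)).
  apply: eq_Rintegral => w _; rewrite /z restrict_iterE.
  case: (boolP (S _)) => [Sw|_]; last by rewrite !mul0r.
  by rewrite rising1// reduced_size_event_gt0.
rewrite /A addnA (rising_martingale J 1 j (n + l) z)//; last first.
  move=> w; rewrite /z restrict_iterE; case: (boolP (S _)) => [Sw _|]; last by rewrite mul0r eqxx.
  exact: has_classes_event.
transitivity (\int[P]_w ((S (restrict_iter n l (Pi (n + l) w)))%:R * (reduced_size J
  (Pi (n + l) w) * reduced_size J (Pi (n + l) w) *
    (j%:R * (V (n + l).+1 (size (Pi (n + l) w)) / V (n + l) (size (Pi (n + l) w))) + 1)))).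
  apply: (discrete_eq (n + l) (fun p => z p *
   (rising (reduced_size J p) 1 *
    (gibbs_backward R alpha V 1 j (n + l) (size p) / V (n + l) (size p))))
   (fun p => (S (restrict_iter n l p))%:R * (reduced_size J p * reduced_size J p *
     (j%:R * (V (n + l).+1 (size p) / V (n + l) (size p)) + 1)))) => // w Vw.
  rewrite /z restrict_iterE; case: (boolP (S _)) => [Sw|_]; last by rewrite !mul0r.
  rewrite rising1; last exact: reduced_size_event_gt0.
  rewrite gibbs_backward1//; last exact: size_bounds.
  by rewrite -/(A l w); field.
by apply: eq_Rintegral => w _; rewrite restrict_iterE.
Qed.

(** Meant for phi = 1 and 2: the means of the rising factorials are known at both times, so the
    equation can be solved for those of A [ratio] and A^2 [ratio]. *)
Lemma rising_step l phi : 0 <= phi ->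
  \int[P]_w ((S (Pi n w))%:R * rising (A l.+1 w) phi) =
  \int[P]_w ((S (Pi n w))%:R * (rising (A l w) phi * (phi * ratio l w + 1))).
Proof.
move=> phi0; have nl : (1 <= n + l)%N by lia.
pose z p := (S (restrict_iter n l p))%:R : R.
transitivity (\int[P]_w (z (Pi (n + l) w) * rising (reduced_size J (Pi (n + l + 1) w)) phi)).
  by apply: eq_Rintegral => w _; rewrite /z restrict_iterE /A addn1 addnS.
rewrite (rising_martingale J phi 1 (n + l) z)//; last first.
  move=> w; rewrite /z restrict_iterE; case: (boolP (S _)) => [Sw _|]; last by rewrite eqxx.
  exact: has_classes_event.
transitivity (\int[P]_w ((S (restrict_iter n l (Pi (n + l) w)))%:R * (rising
  (reduced_size J (Pi (n + l) w)) phi *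
    (phi * (V (n + l).+1 (size (Pi (n + l) w)) / V (n + l) (size (Pi (n + l) w))) + 1)))).
  apply: (discrete_eq (n + l) (fun p => z p *
   (rising (reduced_size J p) phi *
    (gibbs_backward R alpha V phi 1 (n + l) (size p) / V (n + l) (size p))))
   (fun p => (S (restrict_iter n l p))%:R * (rising (reduced_size J p) phi * (phi * (V
     (n + l).+1 (size p) / V (n + l) (size p)) + 1)))) => // w Vw.
  rewrite /z; congr (_ * (_ * _)) => /=.
  have Vr := gibbs_rec _ _ _ hV _ _ (size_bounds (n + l) w nl).
  set k := size _ in Vr Vw *.
  apply: (mulIf Vw); rewrite mulfVK//.
  rewrite (_ : (_ + 1) * _ = phi * V (n + l).+1 k + V (n + l) k); last by field.
  by rewrite [in RHS]Vr; ring.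
by apply: eq_Rintegral => w _; rewrite restrict_iterE.
Qed.

Hypothesis a_gt0 : 0 < a.

(** Every mean in the expanded square has a closed form: [y] for squares, [c] for the cross term,
    [u] and [q] for the means involving [ratio]. *)
Lemma L2_bound l j : (0 < l)%N ->
  \int[P]_w ((S (Pi n w))%:R * ((A (l + j) w) / (l + j)%:R - A l w / l%:R) ^+ 2)
  <= p0 * (a * v1 + a ^+ 2) * (l%:R^-1 - (l + j)%:R^-1).
Proof.
move=> l0.
have dS : discrete (fun w => (S (Pi n w))%:R) by exact: (discrete_comp n (fun p => (S p)%:R)).
have dA i : discrete (A i) by exact: (discrete_comp (n + i) (reduced_size J)).
have dR i : discrete (ratio i).
  exact: (discrete_comp (n + i) (fun p => V (n + i).+1 (size p) / V (n + i) (size p))).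
pose y i := \int[P]_w ((S (Pi n w))%:R * (A i w * A i w)).
pose u i := \int[P]_w ((S (Pi n w))%:R * (A i w * ratio i w)).
pose q i := \int[P]_w ((S (Pi n w))%:R * (A i w * A i w * ratio i w)).
pose c := \int[P]_w ((S (Pi n w))%:R * A l w * A (l + j) w).
have yE i : y i = p0 * (a * (a + 1) * (i%:R * (i%:R - 1) * v2 + i%:R * 2 * v1 + 1)) -
  p0 * (a * (i%:R * v1 + 1)).
  rewrite -reduced_size_mean -reduced_size_mean2; apply/esym/eqP; rewrite subr_eq; apply/eqP.
  rewrite -[X in _ = X + _]mul1r -[X in _ = _ + X]mul1r -discrete_linear.
  + by apply: eq_Rintegral => w _; ring.
  + by apply: discreteM => //; exact: discreteM.
  + exact: discreteM.
have cE : c = y l + j%:R * q l.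
  rewrite /c reduced_size_cross_mean -[X in _ = X + _]mul1r -discrete_linear.
  + by apply: eq_Rintegral => w _; ring.
  + by apply: discreteM => //; exact: discreteM.
  + by apply: discreteM => //; apply: discreteM => //; exact: discreteM.
have uE : u l = p0 * (a * v1).
  have := rising_step l 1 ler01.
  rewrite (_ : \int[P]_w _ = \int[P]_w ((S (Pi n w))%:R * A l.+1 w)); last first.
    apply: eq_Rintegral => w _; case: (boolP (S _)) => [Sw|_]; last by rewrite !mul0r.
    by rewrite rising1// reduced_size_event_gt0.
  rewrite reduced_size_mean.
  rewrite (_ : \int[P]_w _ = 1 * \int[P]_w ((S (Pi n w))%:R * A l w) + 1 * u l); last first.
    rewrite -discrete_linear.
    + apply: eq_Rintegral => w _; case: (boolP (S _)) => [Sw|_];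
      last by rewrite !mul0r !mulr0 addr0.
      by rewrite rising1 ?reduced_size_event_gt0//; ring.
    + exact: discreteM.
    + by apply: discreteM => //; exact: discreteM.
  by rewrite reduced_size_mean -natr1 => H; lra.
have qE : q l = p0 * (a * (a + 1) * (l%:R * v2 + v1) - a * v1).
  have := rising_step l 2 (ler0n _ 2).
  rewrite (_ : \int[P]_w _ = \int[P]_w ((S (Pi n w))%:R * (A l.+1 w * (A l.+1 w + 1)))); last first.
    apply: eq_Rintegral => w _; case: (boolP (S _)) => [Sw|_]; last by rewrite !mul0r.
    by rewrite rising2// reduced_size_event_gt0.
  rewrite reduced_size_mean2.
  rewrite (_ : \int[P]_w _ = 1 * \int[P]_w ((S (Pi n w))%:R * (A l w * (A l w + 1))) +
    2 * (1 * q l + 1 * u l)); last first.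
    rewrite -discrete_linear; first last.
    + by apply: discreteM => //; exact: discreteM.
    + by apply: discreteM => //; apply: discreteM => //; exact: discreteM.
    rewrite -discrete_linear; first last.
    + apply: (discrete2 _ _ (fun x y => 1 * x + 1 * y)).
        by apply: discreteM => //; apply: discreteM => //; exact: discreteM.
      by apply: discreteM => //; exact: discreteM.
    + apply: discreteM => //; exact: (discrete2 _ _ (fun x _ => x * (x + 1)) (dA l) (dA l)).
    apply: eq_Rintegral => w _; case: (boolP (S _)) => [Sw|_];
      last by rewrite !(mul0r, mulr0, addr0).
    by rewrite rising2 ?reduced_size_event_gt0//; ring.
  by rewrite reduced_size_mean2 uE -natr1 => H; lra.
have lR : 0 < l%:R :> R by rewrite ltr0n.
have ljR : 0 < (l + j)%:R :> R by rewrite ltr0n addn_gt0 l0.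
have -> : \int[P]_w ((S (Pi n w))%:R * ((A (l + j) w) / (l + j)%:R - A l w / l%:R) ^+ 2) =
  1 * ((l + j)%:R^-1 ^+ 2 * y (l + j)%N + l%:R^-1 ^+ 2 * y l) + (- 2 / ((l + j)%:R * l%:R)) * c.
  rewrite -discrete_linear; first last.
  + by apply: discreteM => //; exact: discreteM.
  + by apply: discreteM => //; exact: discreteM.
  rewrite -discrete_linear; first last.
  + by apply: discreteM => //; exact: discreteM.
  + apply: (discrete2 _ _ (fun x y => (l + j)%:R^-1 ^+ 2 * x + l%:R^-1 ^+ 2 * y)).
      by apply: discreteM => //; exact: discreteM.
    by apply: discreteM => //; exact: discreteM.
  by apply: eq_Rintegral => w _; field; rewrite -?natrD !gt_eqF.
rewrite cE qE !yE natrD.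
have jR : 0 <= j%:R :> R by rewrite ler0n.
have l1 : 1 <= l%:R :> R by rewrite ler1n.
have p00 : 0 <= p0 by rewrite fine_ge0.
have v20 : 0 <= v2.
  by rewrite divr_ge0// (gibbs_ge0 _ _ _ hV)//; case/andP: mn => -> /leqW/leqW.
have a0 := ltW a_gt0.
rewrite natrD in ljR.
rewrite -subr_ge0.
set L := l%:R in lR ljR l1 *; set j' := j%:R in ljR jR *.
(* Here j' / (L (L + j')) = 1 / L - 1 / (L + j') lies in [0, 1], so both terms on the right are
   nonnegative. *)
have -> : p0 * (a * v1 + a ^+ 2) * (L^-1 - (L + j')^-1) - (1 * ((L + j')^-1 ^+ 2 *
      (p0 * (a * (a + 1) * ((L + j') * (L + j' - 1) * v2 + (L + j') * 2 * v1 + 1)) -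
       p0 * (a * ((L + j') * v1 + 1))) +
      L^-1 ^+ 2 *
      (p0 * (a * (a + 1) * (L * (L - 1) * v2 + L * 2 * v1 + 1)) -
       p0 * (a * (L * v1 + 1)))) +
 - 2 / ((L + j') * L) *
 (p0 * (a * (a + 1) * (L * (L - 1) * v2 + L * 2 * v1 + 1)) -
  p0 * (a * (L * v1 + 1)) +
  j' * (p0 * (a * (a + 1) * (L * v2 + v1) - a * v1)))) =
  p0 * (a * (a + 1) * v2) * (j' / (L * (L + j')))
  + p0 * a ^+ 2 * (j' / (L * (L + j')) * (1 - j' / (L * (L + j')))).
  by field; rewrite !gt_eqF.
have h0 : 0 <= j' / (L * (L + j')) by rewrite divr_ge0// mulr_ge0 ?ltW.
have h1 : j' / (L * (L + j')) <= 1.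
  rewrite ler_pdivrMr ?mulr_gt0// mul1r; nra.
have e1 : 0 <= a * (a + 1) * v2 by exact: mulr_ge0 (mulr_ge0 a0 (addr_ge0 a0 ler01)) v20.
have e2 : 0 <= p0 * a ^+ 2 by rewrite mulr_ge0// exprn_ge0.
apply: addr_ge0; first exact: mulr_ge0 (mulr_ge0 p00 e1) h0.
by apply: mulr_ge0 => //; rewrite mulr_ge0 ?subr_ge0.
Qed.

Let C := p0 * (a * v1 + a ^+ 2).

Lemma L2_bound_ge0 : 0 <= C.
Proof.
have p00 : 0 <= p0 by exact: fine_ge0.
have v10 : 0 <= v1.
  by rewrite divr_ge0// (gibbs_ge0 _ _ _ hV)//; case/andP: mn => -> /leqW.
have a0 := ltW a_gt0.
exact: mulr_ge0 p00 (addr_ge0 (mulr_ge0 a0 v10) (exprn_ge0 2 a0)).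
Qed.

Definition cube_mean l w := (S (Pi n w))%:R * (A (l.+1 ^ 3)%N w / (l.+1 ^ 3)%:R).

Lemma discrete_cube_mean l : discrete (cube_mean l).
Proof.
apply: discreteM; first exact: (discrete_comp n (fun p => (S p)%:R)).
exact: (discrete_comp (n + l.+1 ^ 3) (fun p => reduced_size J p / (l.+1 ^ 3)%:R)).
Qed.

Let discrete_increment k : discrete (fun w => `|cube_mean k.+1 w - cube_mean k w|).
Proof.
exact: (discrete2 _ _ (fun x y => `|x - y|) (discrete_cube_mean _) (discrete_cube_mean _)).
Qed.

(** With e = k + 1, the weight eps = 1 / (e (e + 1)) = 1 / e - 1 / (e + 1) telescopes. Cubes match
    it: 1 / e^3 - 1 / (e + 1)^3 is eps^2 times 3 + 1 / (e (e + 1)), rounded up to 4. *)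
Lemma cube_increment k : \int[P]_w `|cube_mean k.+1 w - cube_mean k w|
  <= (1 + 4 * C) / 2 * (k.+1%:R^-1 - k.+2%:R^-1).
Proof.
have C0 := L2_bound_ge0.
pose e : R := k.+1%:R.
have e0 : 0 < e by rewrite ltr0n.
have e1 : 0 < e + 1 by rewrite addr_gt0.
have eS : k.+2%:R = e + 1 by rewrite natr1.
pose Z w := (S (Pi n w))%:R * ((A (k.+2 ^ 3)%N w) / (k.+2 ^ 3)%:R - A (k.+1 ^ 3)%N w /
  (k.+1 ^ 3)%:R) ^+ 2.
have dZ : discrete Z.
  apply: discreteM; first exact: (discrete_comp n (fun p => (S p)%:R)).
  apply: (discrete2 _ _ (fun x y => (x / (k.+2 ^ 3)%:R - y / (k.+1 ^ 3)%:R) ^+ 2)).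
    exact: (discrete_comp (n + k.+2 ^ 3) (reduced_size J)).
  exact: (discrete_comp (n + k.+1 ^ 3) (reduced_size J)).
have d1 : discrete (fun=> 1 : R) by exact: (discrete_comp 0 (fun=> 1)).
have intZ : \int[P]_w Z w <= C * ((e ^+ 3)^-1 - ((e + 1) ^+ 3)^-1).
  have := L2_bound (k.+1 ^ 3) (k.+2 ^ 3 - k.+1 ^ 3) _.
  rewrite expn_gt0 => /(_ isT).
  by rewrite subnKC ?leq_exp2r// /e -eS -!natrX.
pose eps := (e * (e + 1))^-1.
have eps0 : 0 < eps by rewrite invr_gt0 mulr_gt0.
apply: (@le_trans _ _ (\int[P]_w (eps / 2 * 1 + (2 * eps)^-1 * Z w))).
  apply: le_Rintegral => //.
  - exact: discrete_integrableE.
  - apply: discrete_integrableE.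
    exact: (discrete2 _ _ (fun x y => eps / 2 * x + (2 * eps)^-1 * y) d1 dZ).
  - move=> w _; rewrite /cube_mean /Z -mulrBr normrM normr_nat.
    set x := _ - _; case: (S _); last by rewrite !mul0r mulr0 addr0 mulr1 divr_ge0// ltW.
    (* AM-GM: |x| <= (eps + x^2 / eps) / 2 *)
    rewrite !mul1r mulr1 -[x ^+ 2]real_normK ?num_real//.
    move: `|x| => y; rewrite -subr_ge0.
    rewrite (_ : _ - y = (y - eps) ^+ 2 / (2 * eps)); last by field; rewrite gt_eqF.
    by rewrite divr_ge0 ?sqr_ge0// mulr_ge0// ltW.
rewrite discrete_linear// Rintegral_cst//= probability_setT /= mul1r mulr1.
have : (2 * eps)^-1 * \int[P]_w Z w <= (2 * eps)^-1 * (C * ((e ^+ 3)^-1 - ((e + 1) ^+ 3)^-1)).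
  by rewrite ler_wpM2l// invr_ge0 mulr_ge0// ltW.
rewrite -(lerD2l (eps / 2)) => /le_trans; apply.
rewrite eS -/e -subr_ge0.
rewrite (_ : _ - _ = C * ((e ^+ 2 + e - 1) / (2 * (e * (e + 1)) ^+ 2))); last first.
  by rewrite /eps; field; rewrite !gt_eqF.
have e11 : 1 <= e by rewrite ler1n.
rewrite mulr_ge0// divr_ge0//; first nra.
by rewrite mulr_ge0// sqr_ge0.
Qed.

(** The absolute increments have summable means, the bounds telescoping to at most (1 + 4 C) / 2. *)
Lemma ae_cvg_cube_mean : {ae P, forall w, cvgn (cube_mean ^~ w)}.
Proof.
have C0 := L2_bound_ge0.
have := @ae_cvg_series R _ _ P (fun k w => `|cube_mean k.+1 w - cube_mean k w|) ((1 + 4 * C) / 2).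
move=> /(_ _ _ _)/wrap[].
- by move=> k; have [N [f ->]] := discrete_increment k; exact: discrete_measurable.
- by move=> k w; exact: normr_ge0.
- move=> K.
  have -> : (\sum_(0 <= k < K) \int[P]_w (`|cube_mean k.+1 w - cube_mean k w|)%:E =
     (\sum_(0 <= k < K) \int[P]_w `|cube_mean k.+1 w - cube_mean k w|)%:E)%E.
    rewrite -sumEFin; apply: eq_bigr => k _.
    rewrite /Rintegral fineK//; apply: integrable_fin_num => //.
    exact: discrete_integrableE.
  rewrite lee_fin; apply: (@le_trans _ _ (\sum_(0 <= k < K) (1 + 4 * C) / 2 *
    (k.+1%:R^-1 - k.+2%:R^-1))).
    by apply: ler_sum => k _; exact: cube_increment.
  rewrite -mulr_sumr -[leRHS]mulr1.
  apply: ler_wpM2l.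
    exact: divr_ge0 (addr_ge0 ler01 (mulr_ge0 (ler0n _ 4) C0)) (ler0n _ 2).
  under eq_bigr do rewrite -opprB.
  rewrite sumrN (telescope_sumr (fun k => k.+1%:R^-1))// opprB invr1 lerBlDr lerDl invr_ge0.
  exact: ler0n.
apply: filterS => w cw.
have : cvgn (series (telescope (cube_mean ^~ w))) by exact: normed_cvg.
rewrite telescopeK => cw'.
have -> : cube_mean ^~ w = (fun k => (cube_mean k w - cube_mean 0 w) + cube_mean 0 w).
  by apply/funext => k; rewrite subrK.
by apply: is_cvgD => //; exact: is_cvg_cst.
Qed.

Lemma union_size_mono w l : S (Pi n w) ->
  (union_size J (Pi (n + l) w) <= union_size J (Pi (n + l.+1) w))%N.
Proof.
move=> /(has_classes_event w l) h; rewrite addnS.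
have := partition_step (n + l) w; rewrite inE => /predU1P[->|/mapP[j + ->]].
  by rewrite union_size_open.
by rewrite mem_iota add1n ltnS => jp; rewrite union_size_join// leq_addr.
Qed.

Lemma ae_union_frequency : {ae P, forall w, S (Pi n w) ->
  cvgn (fun N => (union_size J (Pi N w))%:R / N%:R : R)}.
Proof.
apply: filterS ae_cvg_cube_mean => w /cvg_ex[x cx] Sw.
pose T N : R := (union_size J (Pi N w))%:R.
apply/cvg_ex; exists x; apply: (cvg_unshift R T n).
apply: (cvg_along_cubes R (fun l => T (n + l)%N)) => [l||].
- exact: ler0n.
- apply/nondecreasing_seqP => l; rewrite ler_nat; exact: union_size_mono.
(* The gap alpha |J| between size and reduced size is negligible after division by the cube. *)
- rewrite (_ : x = x + alpha * (size J)%:R * 0); last by rewrite mulr0 addr0.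
  rewrite (_ : (fun _ => _) = fun k => cube_mean k w + alpha * (size J)%:R * (k.+1 ^ 3)%:R^-1).
    by apply: cvgD => //; apply: cvgM; [exact: cvg_cst|exact: cvg_inv_cube].
  by apply/funext => k; rewrite /cube_mean Sw mul1r /A /reduced_size mulrBl subrK.
Qed.

End conditioning_event.

(** * Limit frequencies and their moments *)

(** Split along the values of Pi_n: null values are discarded, and each other value is an event to
    which [ae_union_frequency] applies with J = {j}. *)
Lemma ae_class_frequency n j : (1 <= n)%N -> (1 <= j)%N ->
  {ae P, forall w, (j <= size (Pi n w))%N ->
    cvgn (fun N => (size (nth_class (Pi N w) j))%:R / N%:R : R)}.
Proof.
move=> n1 j1.
have : {ae P, forall w i, Pi n w = nth [::] (partition_values n) i ->
    (j <= size (Pi n w))%N ->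
    cvgn (fun N => (size (nth_class (Pi N w) j))%:R / N%:R : R)}.
  apply/ae_foralln => i; set p := nth _ _ _.
  have [p0|p0] := eqVneq (P [set w | Pi n w = p]) 0%E.
    exists [set w | Pi n w = p]; split => // w /= h.
    by apply: contrapT => wp; apply: h => /wp.
  have pgt0 : (0 < P [set w | Pi n w = p])%E by rewrite lt0e p0 measure_ge0.
  have [jp|jp] := leqP j (size p); last first.
    by apply: aeW => w -> h; exfalso; move: jp; rewrite ltnNge h.
  have [w0 w0p] : exists w, Pi n w = p.
    by have [w] := prob_gt0_nonempty pgt0; exists w.
  have op : ordered_partition n p by rewrite -w0p.
  have hj : has_classes [:: j] p by rewrite /has_classes/= j1 jp.
  have hS w : pred1 p (Pi n w) -> [/\ size (Pi n w) = size p,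
      reduced_size [:: j] (Pi n w) = reduced_size [:: j] p & has_classes [:: j] (Pi n w)].
    by move=> /eqP ->.
  have Vp := partition_prob_gt0 n p n1 pgt0.
  have bp : (1 <= size p <= n)%N.
    by rewrite (size_partition_gt0 _ _ op)//= (size_partition_le _ _ op).
  have := ae_union_frequency n (size p) (pred1 p) [:: j] (reduced_size [:: j] p)
     n1 isT isT hS Vp bp (reduced_size_gt0 n [:: j] p op isT hj).
  apply: filterS => w h wp _; have := h (introT eqP wp).
  by rewrite /union_size; under eq_fun do rewrite big_seq1.
apply: filterS => w h; apply: (h (index (Pi n w) (partition_values n))).
by rewrite nth_index// partition_valuesP.
Qed.

Lemma frequency_measurable j : measurable_fun setT (frequency Pi j : Omega -> R).
Proof.
apply: measurable_limn => N.
exact: (discrete_measurable N (fun p => (size (nth_class p j))%:R / N%:R)).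
Qed.

Definition union_frequency J w : R := \sum_(j <- J) frequency Pi j w.

Lemma union_frequency_measurable J : measurable_fun setT (union_frequency J).
Proof.
rewrite /union_frequency; elim: J => [|j J IH].
  by under eq_fun do rewrite big_nil; exact: measurable_cst.
under eq_fun do rewrite big_cons.
by apply: measurable_funD => //; exact: frequency_measurable.
Qed.

Lemma ae_union_cvg n J : (1 <= n)%N -> {ae P, forall w, has_classes J (Pi n w) ->
  (fun N => (union_size J (Pi N w))%:R / N%:R) @ \oo --> union_frequency J w}.
Proof.
move=> n1; elim: J => [|j J IH].
  apply: aeW => w _; rewrite /union_frequency /union_size big_nil.
  under eq_fun do rewrite big_nil mul0r; exact: cvg_cst.
have [j1|j0] := leqP 1 j; last first.
  by apply: aeW => w; rewrite /has_classes /= leqNgt j0.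
apply: filterS2 IH (ae_class_frequency n j n1 j1) => w hJ hj /= /andP[/andP[_ jp] Jp].
rewrite /union_frequency big_cons.
rewrite (_ : (fun _ => _) = fun N => (size (nth_class (Pi N w) j))%:R / N%:R +
  (union_size J (Pi N w))%:R / N%:R).
  by apply: cvgD; [exact: hj|exact: hJ].
by apply/funext => N; rewrite /union_size big_cons natrD mulrDl.
Qed.

(** Dominated convergence for the normalised rising factorials, whose means are exact at each time.
    The existence of this limit is reused to show that [gibbs_limit] converges. *)
Lemma union_frequency_moment n m (S : pred (seq (seq nat))) J a phi :
  (1 <= n)%N -> uniq J -> J != [::] ->
  (forall w, S (Pi n w) ->
    [/\ size (Pi n w) = m, reduced_size J (Pi n w) = a & has_classes J (Pi n w)]) ->
  0 <= phi ->
  (fun l => fine (P [set w | S (Pi n w)]) *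
    (rising a phi * (gibbs_backward _ alpha V phi l n m / V n m)) / (n + l)%:R `^ phi)
   @ \oo --> \int[P]_(w in [set w | S (Pi n w)]) (union_frequency J w `^ phi).
Proof.
move=> n1 uJ J0 hS phi0.
pose A l w := reduced_size J (Pi (n + l) w).
pose f l w : R := (S (Pi n w))%:R * (rising (A l w) phi / (n + l)%:R `^ phi).
have fE l : fine (P [set w | S (Pi n w)]) *
    (rising a phi * (gibbs_backward _ alpha V phi l n m / V n m)) / (n + l)%:R `^ phi
  = \int[P]_w f l w.
  rewrite -(rising_mean n m S J a n1 uJ J0 hS l phi phi0) [LHS]mulrC.
  rewrite -RintegralZl//; first by apply: eq_Rintegral => w _; rewrite /f -/(A l w); ring.
  apply: discrete_integrableE; apply: discreteM.
    exact: (discrete_comp n (fun p => (S p)%:R)).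
  exact: (discrete_comp (n + l) (fun p => rising (reduced_size J p) phi)).
rewrite (_ : (fun _ => _) = fun l => \int[P]_w f l w); last exact/funext.
pose g w : R := (S (Pi n w))%:R * union_frequency J w `^ phi.
have -> : \int[P]_(w in [set w | S (Pi n w)]) (union_frequency J w `^ phi) = \int[P]_w g w.
  rewrite Rintegral_mkcond; apply: eq_Rintegral => w _; rewrite patchE /g.
  case: ifPn => [|]; first by rewrite inE/= => ->; rewrite mul1r.
  by rewrite notin_setE/= => /negP/negbTE ->; rewrite mul0r.
have mS : measurable_fun setT (fun w => (S (Pi n w))%:R : R).
  exact: (discrete_measurable n (fun p => (S p)%:R)).
have mf l : measurable_fun setT (f l).
  apply: measurable_funM => //.
  exact: (discrete_measurable (n + l) (fun p => rising (reduced_size J p) phi / (n + l)%:R `^ phi)).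
have mg : measurable_fun setT g.
  apply: measurable_funM => //; apply: (measurableT_comp (@measurable_powR R phi)).
  exact: union_frequency_measurable.
have N0 l : 0 < (n + l)%:R :> R by rewrite ltr0n addn_gt0 n1.
have A0 w l : S (Pi n w) -> 0 < A l w.
  by apply: (reduced_size_event_gt0 n m S J a).
(* Bounds (A + phi) / N, since A <= N + |alpha| |J| and N >= 1. *)
pose K : R := (1 + `|alpha| * (size J)%:R + phi) `^ phi.
have fK w l : `|f l w| <= K.
  rewrite /f; case: (boolP (S _)) => Sw; last by rewrite mul0r normr0 powR_ge0.
  have Al := A0 w l Sw; have hAp : 0 <= A l w + phi := addr_ge0 (ltW Al) phi0.
  rewrite mul1r ger0_norm; last by rewrite divr_ge0 ?powR_ge0// ltW// rising_gt0.
  apply: (@le_trans _ _ (((A l w + phi) / (n + l)%:R) `^ phi)).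
    rewrite powRM ?hAp ?invr_ge0 ?(ltW (N0 l))//.
    rewrite -[X in _ <= _ * X `^ _]powR_inv1 ?(ltW (N0 l))// -powRrM mulN1r powRN.
    by rewrite ler_wpM2r ?invr_ge0 ?powR_ge0// rising_le.
  rewrite /K; apply: ge0_ler_powR => //; rewrite ?nnegrE.
  - by rewrite divr_ge0 ?hAp ?(ltW (N0 l)).
  - by rewrite !addr_ge0// mulr_ge0.
  rewrite ler_pdivrMr//.
  have [_ _ hJ] := hS w Sw.
  have TN : (union_size J (Pi (n + l) w))%:R <= (n + l)%:R :> R.
    rewrite ler_nat; apply: union_size_le => //.
    by apply: sub_all hJ => j /andP[].
  have N1 : 1 <= (n + l)%:R :> R by rewrite ler1n addn_gt0 n1.
  have Ja : - alpha * (size J)%:R <= `|alpha| * (size J)%:R.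
    by rewrite ler_wpM2r// -normrN ler_norm.
  have b0 : 0 <= `|alpha| * (size J)%:R + phi by rewrite addr_ge0// mulr_ge0.
  have : (`|alpha| * (size J)%:R + phi) * 1 <= (`|alpha| * (size J)%:R + phi) * (n + l)%:R.
    by rewrite ler_wpM2l.
  rewrite /A /reduced_size; lra.
have fg w : (S (Pi n w) -> (fun N => (union_size J (Pi N w))%:R / N%:R) @ \oo -->
  union_frequency J w) ->
    (fun l => f l w) @ \oo --> g w.
  rewrite /f /g; case: (boolP (S _)) => Sw; last first.
    by move=> _; under eq_fun do rewrite mul0r; rewrite mul0r; exact: cvg_cst.
  move=> /(_ isT) cT; under eq_fun do rewrite mul1r; rewrite mul1r.
  pose U := union_frequency J w.
  have invN : (fun l => (n + l)%:R^-1 : R) @ \oo --> (0 : R).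
    pose u l : R := (n + l)%:R^-1; rewrite -(cvg_shiftS u) /u /=.
    by have := cvg_invS R n; under eq_fun do rewrite addnS addnC -addnS.
  have cA (b : R) : (fun l => (A l w + b) / (n + l)%:R) @ \oo --> U.
    rewrite (_ : (fun _ => _) = fun l => (union_size J (Pi (n + l) w))%:R / (n + l)%:R
      + (b - alpha * (size J)%:R) * (n + l)%:R^-1); last first.
      by apply/funext => l; rewrite /A /reduced_size; ring.
    rewrite (_ : U = U + (b - alpha * (size J)%:R) * 0); last by rewrite mulr0 addr0.
    apply: cvgD; last by apply: cvgM => //; exact: cvg_cst.
    pose u N : R := (union_size J (Pi N w))%:R / N%:R.
    have : u @ \oo --> U by exact: cT.
    by rewrite -(cvg_shiftn n u) /u /=; under eq_fun do rewrite addnC.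
  have U0 : 0 <= U.
    rewrite /U -(cvg_lim _ cT)//; apply: limr_ge; first by apply/cvg_ex; exists U.
    by near=> N; rewrite divr_ge0.
  (* The positive part of (A - 1) / N: the lower bound on the rising factorial requires A > 1, while
     A may stay below. *)
  pose lo l := ((A l w - 1) / (n + l)%:R + `|(A l w - 1) / (n + l)%:R|) / 2.
  have clo : lo @ \oo --> U.
    rewrite (_ : U = (U + `|U|) * 2^-1); last by rewrite ger0_norm//; field.
    apply: cvgM; last exact: cvg_cst.
    by apply: cvgD; [exact: cA|apply: cvg_norm; exact: cA].
  have lo0 l : 0 <= lo l.
    rewrite divr_ge0//; set x := _ / _; have := ler_norm (- x); rewrite normrN; lra.
  apply: (@squeeze_cvgr _ _ _ _ (fun l => lo l `^ phi) (fun l =>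
    ((A l w + phi) / (n + l)%:R) `^ phi)).
  - near=> l.
    have Al := A0 w l Sw; have hAp : 0 <= A l w + phi := addr_ge0 (ltW Al) phi0.
    have invE : ((n + l)%:R `^ phi)^-1 = (n + l)%:R^-1 `^ phi :> R.
      by rewrite -powRN -mulN1r powRrM powR_inv1// ltW.
    rewrite invE; apply/andP; split; last first.
      rewrite powRM ?hAp ?invr_ge0 ?(ltW (N0 l))//.
      by rewrite ler_wpM2r ?powR_ge0// rising_le.
    rewrite /lo; have [A1|A1] := leP (A l w) 1.
      rewrite ler0_norm; last by rewrite pmulr_lle0 ?invr_gt0// subr_le0.
      rewrite subrr mul0r; have [->|phin0] := eqVneq phi 0.
        by rewrite !powRr0 rising0// mulr1.
      by rewrite powR0// mulr_ge0 ?powR_ge0// ltW// rising_gt0.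
    have Am : 0 <= A l w - 1 by rewrite subr_ge0 ltW.
    rewrite ger0_norm; last by rewrite divr_ge0// ltW.
    have half2 (x : R) : (x + x) / 2 = x by lra.
    rewrite half2.
    rewrite powRM// ?invr_ge0 ?(ltW (N0 l))//.
    by rewrite ler_wpM2r ?powR_ge0// rising_ge.
  - exact: powR_cvg.
  - apply: powR_cvg => // l.
    exact: divr_ge0 (addr_ge0 (ltW (A0 w l Sw)) phi0) (ltW (N0 l)).
have [] := @dominated_convergence _ _ _ P setT measurableT (fun l w => (f l w)%:E)
  (fun w => (g w)%:E) (fun=> K%:E) _ _ _ _ _.
- by move=> l; apply/measurable_EFinP.
- exact/measurable_EFinP.
- apply: filterS (ae_union_cvg n J n1) => w h _.
  apply: cvg_EFin; first by near=> l.
  by apply: fg => Sw; apply: h; have [] := hS w Sw.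
- by apply: finite_measure_integrable_cst.
- by apply: aeW => w l _; rewrite lee_fin.
move=> ig _ cv.
rewrite /Rintegral; apply: fine_cvg.
rewrite fineK; last exact: integrable_fin_num.
exact: cv.
Unshelve. all: by end_near. Qed.

(** * Record indices and existence of the limits *)

Definition is_record m n p := (size p == m) && (nth_class p m == [:: n]).

(** The least element of a class is fixed at its birth, when the class is {n} and the last of m;
    later steps change neither its head nor its rank. *)
Lemma record_indexE m n : (1 <= m)%N ->
  record_index Pi m n = [set w | is_record m n (Pi n w)].
Proof.
move=> m1; apply/seteqP; split => w /=; last first.
  by move=> /andP[/eqP sm /eqP cm]; exists n; rewrite sm cm.
move=> [N []]; elim: N => [|N IH] mN.
  by rewrite partition0 leqNgt m1 in mN.
have := partition_step N w; rewrite inE => /predU1P[E|/mapP[j + E]].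
  have [mN'|mN'] := leqP m (size (Pi N w)).
    by rewrite E nth_open_class ?m1//; exact: IH.
  have mE : m = (size (Pi N w)).+1.
    by apply/eqP; rewrite eqn_leq mN' andbT; move: mN; rewrite E size_rcons.
  have cE : nth_class (Pi N.+1 w) m = [:: N.+1].
    by rewrite E mE /nth_class /open_class nth_rcons ltnn eqxx.
  by rewrite cE /= => <-; rewrite /is_record cE eqxx E size_rcons mE eqxx.
rewrite mem_iota add1n ltnS => jp.
have mN' : (m <= size (Pi N w))%N by move: mN; rewrite E size_join_class.
rewrite E nth_join_class//; last by case/andP: jp.
case: eqVneq => [mj|_]; last exact: IH.
have := class_size_gt0 _ _ _ (ordPi N w) jp; rewrite -mj.
move: (IH mN'); case: (nth_class (Pi N w) m) => //= x c h _; exact: h.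
Qed.

(** As zeros propagate, a nonzero V_{n,k} forces V_{n-1,k-1} to be nonzero, or V_{n-1,1} if k = 1.
    The partition comes from opening a class in the first case and from extending the only class in
    the second. *)
Lemma partition_mass n k : (1 <= k <= n)%N -> V n k != 0 ->
  exists2 p, size p = k & (0 < P [set w | Pi n w = p])%E.
Proof.
have pos (p q : seq (seq nat)) N : cond_prob P [set w | Pi N.+1 w = q] [set w | Pi N w = p] != 0 ->
    (0 < P [set w | Pi N.+1 w = q])%E.
  move=> c0; rewrite lt0e measure_ge0 andbT; apply: contraNneq c0 => q0.
  rewrite /cond_prob (_ : P (_ `&` _) = 0%E) ?mul0r//.
  apply/eqP; rewrite eq_le measure_ge0 andbT -q0 le_measure ?inE//.
  exact: measurableI.
case: n => [|n]; first by case: k.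
elim: n k => [|n IH] k kn Vk.
  exists [:: [:: 1%N]]; first by case: k kn {Vk} => [|[|]].
  rewrite (_ : [set _ | _] = setT) ?probability_setT ?lte01//.
  apply/seteqP; split => // w _ /=; have := partition_step 0 w.
  by rewrite partition0 /= inE => /eqP.
have [k2|k2] := leqP 2 k.
  case: k k2 kn Vk => // k k2 kn Vk.
  have kn' : (1 <= k <= n.+1)%N by rewrite -ltnS k2 -ltnS; case/andP: kn.
  have Vk' : V n.+1 k != 0.
    apply: contraNneq Vk => V0.
    by have [_ ->] := gibbs_eq0_succ _ _ _ alpha_lt1 hV _ _ kn' V0.
  have [p sp p0] := IH k kn' Vk'.
  exists (open_class n.+2 p); first by rewrite size_rcons sp.
  apply: (pos p); have [_ /(_ n.+1 p isT p0)[-> _]] := hPi.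
  by rewrite sp mulf_neq0// invr_neq0.
have k1 : k = 1%N by lia.
rewrite k1 in kn Vk *.
have kn' : (1 <= 1 <= n.+1)%N by [].
have Vk' : V n.+1 1 != 0.
  apply: contraNneq Vk => V0.
  by have [-> _] := gibbs_eq0_succ _ _ _ alpha_lt1 hV _ _ kn' V0.
have [p sp p0] := IH 1%N kn' Vk'.
have [w0 w0p] : exists w, Pi n.+1 w = p.
  by have [w] := prob_gt0_nonempty p0; exists w.
exists (join_class n.+2 1 p); first by rewrite size_join_class sp.
apply: (pos p); have [_ /(_ n.+1 p isT p0)[_ ->]] := hPi; last by rewrite sp.
have op : ordered_partition n.+1 p by rewrite -w0p.
have c1 : 1 <= (size (nth_class p 1))%:R :> R.
  by rewrite ler1n (class_size_gt0 _ _ _ op)// sp.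
rewrite sp mulf_neq0//.
  rewrite mulf_neq0 ?invr_neq0//; first by rewrite gt_eqF// subr_gt0 (lt_le_trans _ c1).
  by rewrite gt_eqF// (gibbs_denom_gt0 _ _ alpha_lt1).
rewrite -{1}(divff Vk') -mulrBl [in X in X / _](gibbs_rec _ _ _ hV _ _ kn') addrK.
by rewrite !mulf_neq0 ?invr_neq0// gt_eqF// (gibbs_denom_gt0 _ _ alpha_lt1).
Qed.

(** On Pi_n = p, with p of positive probability, the moment convergence for the first class is that
    of this sequence times the nonzero constant q a / V_{n,k}. *)
Lemma gibbs_limit_is_cvg phi n k : 0 <= phi -> (1 <= k <= n)%N ->
  cvgn (fun l => gibbs_backward _ alpha V phi l n k / (n + l)%:R `^ phi).
Proof.
move=> phi0 kn; have [V0|V0] := eqVneq (V n k) 0.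
  rewrite (_ : (fun _ => _) = fun=> 0); first exact: is_cvg_cst.
  by apply/funext => l; rewrite (gibbs_backward_eq0 _ _ _ alpha_lt1 hV _ _ _ _ kn)// mul0r.
have [p sp p0] := partition_mass n k kn V0.
have [w0 w0p] : exists w, Pi n w = p.
  by have [w] := prob_gt0_nonempty p0; exists w.
have n1 : (1 <= n)%N by case/andP: kn; exact: leq_trans.
have op : ordered_partition n p by rewrite -w0p.
have h1 : has_classes [:: 1%N] p by rewrite /has_classes/= sp andbT; case/andP: kn.
have hS w : pred1 p (Pi n w) -> [/\ size (Pi n w) = k,
    reduced_size [:: 1%N] (Pi n w) = reduced_size [:: 1%N] p & has_classes [:: 1%N] (Pi n w)].
  by move=> /eqP ->.
have := union_frequency_moment n k (pred1 p) [:: 1%N] _ phi n1 isT isT hS phi0.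
set q := fine _; set a := rising _ _; set L := \int[P]_(w in _) _ => cL.
have q0 : 0 < q.
  rewrite /q (_ : [set w | _] = [set w | Pi n w = p]); last first.
    by apply/seteqP; split => w /=; [move/eqP|move/eqP].
  by rewrite fine_gt0// p0 (le_lt_trans (probability_le1 _ _))// ltry.
have a0 : 0 < a by apply: rising_gt0 => //; exact: (reduced_size_gt0 n [:: 1%N] p op isT h1).
apply/cvg_ex; exists (V n k / (q * a) * L).
rewrite (_ : (fun _ => _) = fun l => V n k / (q * a) *
   (q * (a * (gibbs_backward _ alpha V phi l n k / V n k)) / (n + l)%:R `^ phi)).
  by apply: cvgM; [exact: cvg_cst|exact: cL].
apply/funext => l.
have : 0 < (n + l)%:R `^ phi by rewrite powR_gt0// ltr0n addn_gt0 n1.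
by move: (_ `^ _) => y y0; field; rewrite V0 !gt_eqF.
Qed.

Lemma union_frequency_momentE n m (S : pred (seq (seq nat))) J a phi :
  (1 <= m <= n)%N -> uniq J -> J != [::] ->
  (forall w, S (Pi n w) ->
    [/\ size (Pi n w) = m, reduced_size J (Pi n w) = a & has_classes J (Pi n w)]) ->
  0 <= phi ->
  \int[P]_(w in [set w | S (Pi n w)]) (union_frequency J w `^ phi) =
  fine (P [set w | S (Pi n w)]) *
    (rising a phi * (gibbs_limit _ alpha V phi n m / V n m)).
Proof.
move=> mn uJ J0 hS phi0.
have n1 : (1 <= n)%N by case/andP: mn; exact: leq_trans.
apply: (cvg_unique _ (union_frequency_moment n m S J a phi n1 uJ J0 hS phi0)) => //.
set q := fine _.
rewrite (_ : (fun _ => _) = fun l => q * (rising a phi * (V n m)^-1) *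
   (gibbs_backward _ alpha V phi l n m / (n + l)%:R `^ phi)); last first.
  by apply/funext => l; ring.
have -> : q * (rising a phi * (gibbs_limit _ alpha V phi n m / V n m)) =
    q * (rising a phi * (V n m)^-1) * gibbs_limit _ alpha V phi n m by ring.
by apply: cvgM; [exact: cvg_cst|exact: gibbs_limit_is_cvg].
Qed.

Lemma record_moment m n J a phi : (1 <= m)%N -> uniq J -> J != [::] ->
  (forall w, is_record m n (Pi n w) ->
    reduced_size J (Pi n w) = a /\ has_classes J (Pi n w)) ->
  0 <= phi -> (0 < P (record_index Pi m n))%E ->
  cond_expectation P (fun w => union_frequency J w `^ phi) (record_index Pi m n)
  = rising a phi * (gibbs_limit _ alpha V phi n m / V n m).
Proof.
move=> m1 uJ J0 hJ phi0; rewrite record_indexE// => B0.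
have mn : (1 <= m <= n)%N.
  rewrite m1 /=; have [w /andP[/eqP <- _]] : exists w, is_record m n (Pi n w).
    by have [w] := prob_gt0_nonempty B0; exists w.
  exact: size_partition_le (ordPi n w).
have q0 : 0 < fine (P [set w | is_record m n (Pi n w)]).
  rewrite fine_gt0// B0 (le_lt_trans (probability_le1 _ _)) ?ltry//.
  exact: event_measurable.
rewrite /cond_expectation (union_frequency_momentE n m (is_record m n) J a)//.
  by rewrite mulrC mulKf// gt_eqF.
by move=> w h; have [h1 h2] := hJ w h; split => //; case/andP: h => /eqP.
Qed.

Lemma gibbs_limit11 phi : 0 <= phi ->
  gibbs_limit _ alpha V phi 1 1 =
  fine ('E_P[(fun w => frequency Pi 1 w `^ phi)%R])%E / rising (1 - alpha) phi.
Proof.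
move=> phi0.
have P1 w : Pi 1 w = [:: [:: 1%N]].
  by have := partition_step 0 w; rewrite partition0 /= inE => /eqP.
have hS w : predT (Pi 1 w) -> [/\ size (Pi 1 w) = 1%N,
    reduced_size [:: 1%N] (Pi 1 w) = 1 - alpha & has_classes [:: 1%N] (Pi 1 w)].
  by rewrite P1 /reduced_size /union_size big_seq1 /= mulr1.
have := union_frequency_momentE 1 1 predT [:: 1%N] (1 - alpha) phi isT isT isT hS phi0.
have -> : [set w | predT (Pi 1 w)] = setT by apply/seteqP.
have -> : V 1 1 = 1 by case: hV.
rewrite probability_setT /= mul1r divr1 unlock => h.
have r0 : 0 < rising (1 - alpha) phi by rewrite rising_gt0// subr_gt0.
apply: (mulfI (lt0r_neq0 r0)); rewrite -h mulrCA mulfV ?gt_eqF// mulr1.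
by apply: eq_Rintegral => w _; rewrite /union_frequency big_seq1.
Qed.

End gibbs_partition.

Theorem proposition5 (R : realType) (alpha : R) (V : nat -> nat -> R)
    (alpha_lt1 : alpha < 1) (hV : gibbs_coefficients alpha V) :
  exists Vphi : R -> nat -> nat -> R,
  forall (d : measure_display) (Omega : measurableType d)
    (P : probability Omega R) (Pi : nat -> Omega -> seq (seq nat)),
  EGP P alpha V Pi ->
  let X : nat -> Omega -> R := frequency Pi in
  let W : nat -> Omega -> R := cumulative_frequency Pi in
  let M : R -> R := fun phi => fine ('E_P[(fun w => X 1%N w `^ phi)%R])%E in
  [/\ moment_family alpha V M Vphi,
      forall Vphi' : R -> nat -> nat -> R, moment_family alpha V M Vphi' ->
        forall (phi : R) (n k : nat), 0 <= phi -> (1 <= k <= n)%N ->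
          Vphi' phi n k = Vphi phi n k &
      forall (m n : nat) (phi : R), (1 <= m)%N -> 0 <= phi ->
        (0 < P (record_index Pi m n))%E ->
        cond_expectation P (fun w => W m w `^ phi) (record_index Pi m n)
          = rising (n%:R - alpha * m%:R) phi * (Vphi phi n m / V n m) /\
        cond_expectation P (fun w => X m w `^ phi) (record_index Pi m n)
          = rising (1 - alpha) phi * (Vphi phi n m / V n m)].
Proof.
(* The witness precedes the partition, which only enters through the convergence [cv]. *)
exists (gibbs_limit _ alpha V) => d Omega P Pi hPi X W M.
have family : moment_family alpha V M (gibbs_limit _ alpha V).
  split=> [n k kn|phi phi0]; first exact: gibbs_limit0.
  have cv n k : (1 <= k <= n)%N ->
      cvgn (fun l => gibbs_backward _ alpha V phi l n k / (n + l)%:R `^ phi).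
    by move=> kn; apply: (gibbs_limit_is_cvg P _ _ Pi).
  split.
  - exact: gibbs_limit11.
  - by move=> n k kn; apply: gibbs_limit_rec; apply: cv; case/andP: kn => k1 kn;
    rewrite ?k1 ?ltnS ?leqW.
  - by move=> n k kn; apply: gibbs_limitD1 => //; apply: cv => //;
    case/andP: kn => k1 kn; rewrite ?k1 leqW.
split=> //.
  by move=> Vphi' family'; apply: moment_family_unique family family'.
move=> m n phi m1 phi0 B0.
have ordPi w : ordered_partition n (Pi n w) by case: hPi => -[].
have momentJ J a : uniq J -> J != [::] ->
    (forall w, is_record m n (Pi n w) ->
      reduced_size alpha J (Pi n w) = a /\ has_classes J (Pi n w)) ->
    cond_expectation P (fun w => union_frequency Pi J w `^ phi) (record_index Pi m n)
    = rising a phi * (gibbs_limit _ alpha V phi n m / V n m).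
  by move=> uJ J0 hJ; exact: (record_moment P alpha V Pi).
split.
  have -> : (fun w => W m w `^ phi) = fun w => union_frequency Pi (iota 1 m) w `^ phi.
    apply/funext => w; congr (_ `^ _).
    by rewrite /W /cumulative_frequency /union_frequency /index_iota subSS subn0.
  apply: momentJ; [exact: iota_uniq|by case: m m1 {B0}|].
  move=> w /andP[/eqP sm _]; split.
    (* The first m classes are all the classes of Pi_n, so their sizes add up to n. *)
    by rewrite /reduced_size /union_size -{1}sm (sumn_size_classes n)// size_iota.
  by apply/allP => j; rewrite mem_iota sm add1n ltnS.
have -> : (fun w => X m w `^ phi) = fun w => union_frequency Pi [:: m] w `^ phi.
  by apply/funext => w; congr (_ `^ _); rewrite /union_frequency big_seq1.
(* At the record time the m-th class is the singleton {n}, of reduced size 1 - alpha. *)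
apply: momentJ => // w /andP[/eqP sm /eqP cm]; split.
  by rewrite /reduced_size /union_size big_seq1 cm /= mulr1.
by rewrite /has_classes /= sm m1 leqnn.
Qed.
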